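(* Let $f:\mathbb{R}^D\to\mathbb{R}$ be continuous with effective dimension $d_e$, $d_e<D$ and $d_e\le d$, with effective subspace $\mathcal{T}$ and constant subspace $\mathcal{T}^\perp$ spanned by the columns of the orthonormal matrices $U\in\mathbb{R}^{D\times d_e}$ and $V\in\mathbb{R}^{D\times(D-d_e)}$, respectively. Let $\boldsymbol{x}^*$ be any global minimizer of $f$ over $\mathcal{X}=[-1,1]^D$, let $\boldsymbol{p}\in\mathcal{X}$ be a given vector, and let $A$ be a $D\times d$ Gaussian matrix. Assume that $\boldsymbol{p}_\top\neq\boldsymbol{x}^*_\top$. Then the random vector $\boldsymbol{w}:=V^TA\boldsymbol{y}_2^*$ follows a $(D-d_e)$-dimensional $t$-distribution with parameters $d-d_e+1$ and $\frac{\|\boldsymbol{x}_\top^*-\boldsymbol{p}_\top\|^2}{d-d_e+1}I$, and its probability density function $g(\bar{\boldsymbol{w}})$ is given by $$g(\bar{\boldsymbol{w}})=\frac{1}{(\sqrt{\pi}\,\|\boldsymbol{x}_\top^*-\boldsymbol{p}_\top\|)^m}\left[\frac{\Gamma(\frac{m+n}{2})}{\Gamma(\frac n2)}\right]\left(1+\frac{\bar{\boldsymbol{w}}^T\bar{\boldsymbol{w}}}{\|\boldsymbol{x}_\top^*-\boldsymbol{p}_\top\|^2}\right)^{-(m+n)/2},$$ where $m=D-d_e$ and $n=d-d_e+1$.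
   Context: A function $f:\mathbb{R}^D\to\mathbb{R}$ has effective dimension $d_e$ if there is a linear subspace $\mathcal{T}$ of dimension $d_e$ such that $f(\boldsymbol{x}_\top+\boldsymbol{x}_\perp)=f(\boldsymbol{x}_\top)$ for all $\boldsymbol{x}_\top\in\mathcal{T}$ and $\boldsymbol{x}_\perp\in\mathcal{T}^\perp$, and $d_e$ is the smallest integer with this property. $\mathcal{T}$ and $\mathcal{T}^\perp$ are called the effective and constant subspaces of $f$. For $\boldsymbol{x}\in\mathbb{R}^D$, $\boldsymbol{x}_\top=UU^T\boldsymbol{x}$ and $\boldsymbol{x}_\perp=VV^T\boldsymbol{x}$ denote the Euclidean projections onto $\mathcal{T}$ and $\mathcal{T}^\perp$. A Gaussian matrix is a random matrix with independent $\mathcal{N}(0,1)$ entries. $\|\cdot\|$ is the Euclidean norm. Given $\boldsymbol{x}^*$, let $\mathcal{G}^*:=\boldsymbol{x}^*_\top+\mathcal{T}^\perp\subseteq\mathbb{R}^D$ and $\mathcal{S}^*:=\{\boldsymbol{y}\in\mathbb{R}^d: A\boldsymbol{y}+\boldsymbol{p}\in\mathcal{G}^*\}$ (nonempty with probability one). $\boldsymbol{y}_2^*:=\arg\min\{\|\boldsymbol{y}\|_2:\boldsymbol{y}\in\mathcal{S}^*\}$ is the minimal Euclidean norm element of $\mathcal{S}^*$. An $l$-dimensional random vector has the $t$-distribution with parameters $\nu$ and $\Sigma$ if its density is $\frac{1}{(\pi\nu)^{l/2}}\frac{\Gamma((l+\nu)/2)}{\Gamma(\nu/2)}\det(\Sigma)^{-1/2}\left(1+\frac1\nu\boldsymbol{t}^T\Sigma^{-1}\boldsymbol{t}\right)^{-(l+\nu)/2}$.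 *)

(* Defs.v *)
From HB Require Import structures.
From mathcomp Require Import all_boot all_order all_algebra.
From mathcomp Require Import all_classical all_reals all_analysis.

Set Implicit Arguments.
Unset Strict Implicit.
Unset Printing Implicit Defensive.

Import Order.TTheory GRing.Theory Num.Theory.
Import numFieldNormedType.Exports.

Local Open Scope classical_set_scope.
Local Open Scope ring_scope.

Definition dotv (R : realType) (n : nat) (u v : 'cV[R]_n) : R :=
  \sum_(i < n) u i ord0 * v i ord0.

(* The norm [`|u|] that MathComp-Analysis puts on matrices is the sup norm. *)
Definition enorm (R : realType) (n : nat) (u : 'cV[R]_n) : R :=
  Num.sqrt (dotv u u).

Definition orthocomp (R : realType) (n : nat) (S : set 'cV[R]_n) :
  set 'cV[R]_n := [set v | forall u, S u -> dotv u v = 0].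

Definition orthonormal_columns (R : realType) (n k : nat) (Q : 'M[R]_(n, k)) :=
  Q^T *m Q = 1%:M.

Definition column_span (R : realType) (n k : nat) (Q : 'M[R]_(n, k)) :
  {vspace 'cV[R]_n} := <<[seq col j Q | j <- enum 'I_k]>>%VS.

Definition constant_along_ortho (R : realType) (D : nat) (f : 'cV[R]_D -> R)
    (T : {vspace 'cV[R]_D}) :=
  forall xt xp : 'cV[R]_D,
    xt \in T -> orthocomp [set` T] xp -> f (xt + xp) = f xt.

Definition is_effective_subspace (R : realType) (D : nat) (f : 'cV[R]_D -> R)
    (de : nat) (T : {vspace 'cV[R]_D}) :=
  [/\ \dim T = de, constant_along_ortho f T &
      forall T' : {vspace 'cV[R]_D},
        constant_along_ortho f T' -> (de <= \dim T')%N].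

Definition global_minimizer (R : realType) (D : nat) (f : 'cV[R]_D -> R)
    (X : set 'cV[R]_D) (x : 'cV[R]_D) :=
  X x /\ forall z, X z -> f x <= f z.

Definition symmetric_box (R : realType) (D : nat) : set 'cV[R]_D :=
  [set x | forall i, -1 <= x i ord0 <= 1].

Definition min_norm_points (R : realType) (n : nat) (S : set 'cV[R]_n) :
  set 'cV[R]_n := [set y | S y /\ forall z, S z -> enorm y <= enorm z].

(* A nonempty closed convex set has exactly one such point; the value [0] is
   used when there is none. *)
Definition min_norm_point (R : realType) (n : nat) (S : set 'cV[R]_n) :
  'cV[R]_n := xget 0 (min_norm_points S).

Definition column_proj (R : realType) (n k : nat) (Q : 'M[R]_(n, k))
    (x : 'cV[R]_n) : 'cV[R]_n := Q *m Q^T *m x.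

Definition Gstar (R : realType) (D : nat) (T : {vspace 'cV[R]_D})
    (xT : 'cV[R]_D) : set 'cV[R]_D :=
  [set xT + v | v in orthocomp [set` T]].

Definition Sstar (R : realType) (D d : nat) (G : set 'cV[R]_D)
    (M : 'M[R]_(D, d)) (p : 'cV[R]_D) : set 'cV[R]_d :=
  [set y | G (M *m y + p)].

(* The sigma-algebra on matrices is the one generated by the entries (hence the
   Borel one), as the library does for [n.-tuple T]. *)

Definition entry_cylinders (R : realType) (m n : nat) :
    set (set 'M[R]_(m, n)) :=
  [set B | exists i j (C : set R),
     measurable C /\ B = [set M : 'M[R]_(m, n) | C (M i j)]].

HB.instance Definition _ (R : realType) (m n : nat) :=
  @isMeasurable.Build
    (sigma_display (@entry_cylinders R m n))
    'M[R]_(m, n) <<s @entry_cylinders R m n >>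
    (@sigma_algebra0 _ _ _) (@sigma_algebraC _ _) (@sigma_algebra_bigcup _ _ _).

Section lebesgue_cv.
Variable R : realType.

Definition cons_cv (n : nat) (xv : measurableTypeR R * 'cV[R]_n) :
  'cV[R]_n.+1 := col_mx (const_mx xv.1 : 'cV_1) xv.2.

Definition uncons_cv (n : nat) (v : 'cV[R]_n.+1) :
  measurableTypeR R * 'cV[R]_n := (v ord0 ord0, \col_i v (lift ord0 i) ord0).

Lemma cons_cvK n : cancel (@cons_cv n) (@uncons_cv n).
Proof.
move=> [x v]; rewrite /uncons_cv /cons_cv /=; congr pair.
  rewrite [ord0](_ : _ = lshift n (ord0 : 'I_1)); last exact/val_inj.
  by rewrite [LHS]col_mxEu mxE.
apply/colP => i; rewrite mxE.
rewrite (_ : lift ord0 i = rshift 1 i); last exact/val_inj.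
by rewrite [LHS]col_mxEd.
Qed.

Lemma measurable_entry m n (i : 'I_m) (j : 'I_n) :
  measurable_fun [set: 'M[R]_(m, n)] (fun M : 'M[R]_(m, n) => M i j).
Proof.
move=> _ C mC; rewrite setTI; apply: sub_sigma_algebra.
by exists i, j, C.
Qed.

Lemma measurable_fun_mx d (T : measurableType d) m n (F : T -> 'M[R]_(m, n)) :
  (forall i j, measurable_fun [set: T] (fun t => F t i j)) ->
  measurable_fun [set: T] F.
Proof.
move=> mF; apply: (measurability (@entry_cylinders R m n)) => //.
move=> _ [_ [i [j [C [mC ->]]]] <-]; exact: mF.
Qed.

Lemma measurable_cons_cv n : measurable_fun setT (@cons_cv n).
Proof.
apply: measurable_fun_mx => i j; rewrite ord1.
have [k ->|k ->] := @split_ordP 1 n i.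
  rewrite (_ : (fun _ => _) = fst); first exact: measurable_fst.
  by apply/funext => -[x v]; rewrite /cons_cv [LHS]col_mxEu ord1 mxE.
rewrite (_ : (fun _ => _) = (fun v : 'cV[R]_n => v k ord0) \o snd).
  by apply: measurableT_comp; [exact: measurable_entry|exact: measurable_snd].
by apply/funext => -[x v]; rewrite /cons_cv [LHS]col_mxEd.
Qed.

Lemma measurable_uncons_cv n : measurable_fun setT (@uncons_cv n).
Proof.
apply: measurable_fun_pair; first exact: measurable_entry.
apply: measurable_fun_mx => i j.
rewrite (_ : (fun _ => _) = fun v : 'cV[R]_n.+1 => v (lift ord0 i) ord0).
  exact: measurable_entry.
by apply/funext => v; rewrite mxE.
Qed.

Section step.
Variables (n : nat) (mu : {sigma_finite_measure set 'cV[R]_n -> \bar R}).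

(* Product of the Lebesgue measure on [R] with [mu], seen through the
   identification of [R * 'cV_n] with ['cV_n.+1]. *)
Definition lebesgue_cv_step : set 'cV[R]_n.+1 -> \bar R :=
  pushforward (lebesgue_measure \x mu)%E (@cons_cv n).

HB.instance Definition _ := Measure.copy lebesgue_cv_step
  (measure_function_pushforward__canonical__measure_function_Measure
     (lebesgue_measure \x mu)%E (@measurable_cons_cv n)).

Let sigma_finite_step : sigma_finite setT lebesgue_cv_step.
Proof.
have [F FT Ffin] : sigma_finite setT (lebesgue_measure \x mu)%E.
  have /sigma_finiteP[F [TF ndF Foo]] := sigma_finiteT (@lebesgue_measure R).
  have /sigma_finiteP[G [TG ndG Goo]] := sigma_finiteT mu.
  exists (fun k => F k `*` G k).
    rewrite -setXTT TF TG predeqE => -[x y]; split.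
      move=> [/= [k _ Fkx] [l _ Gly]]; exists (maxn k l) => //; split.
      - by move: x Fkx; exact/subsetPset/ndF/leq_maxl.
      - by move: y Gly; exact/subsetPset/ndG/leq_maxr.
    by move=> [k _ []/= ? ?]; split; exists k.
  move=> k; have [? ?] := Foo k; have [? ?] := Goo k.
  split; first exact: measurableX.
  by rewrite product_measure1E// lte_mul_pinfty// ge0_fin_numE.
exists (fun k => @uncons_cv n @^-1` F k).
  by rewrite -preimage_bigcup -FT preimage_setT.
move=> k; have [mF Foo] := Ffin k; split.
  by rewrite -[X in measurable X]setTI; exact: measurable_uncons_cv.
rewrite /lebesgue_cv_step /pushforward -comp_preimage.
rewrite (_ : _ \o _ = id) ?preimage_id//.
by apply/funext => x /=; rewrite cons_cvK.
Qed.

HB.instance Definition _ :=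
  Measure_isSigmaFinite.Build _ _ _ lebesgue_cv_step sigma_finite_step.

End step.

Fixpoint lebesgue_cv (n : nat) :
    {sigma_finite_measure set 'cV[R]_n -> \bar R} :=
  match n with
  | 0 => \d_ (0 : 'cV[R]_0)
  | k.+1 => lebesgue_cv_step (lebesgue_cv k)
  end.

End lebesgue_cv.

Definition has_pdf (R : realType) (d : measure_display)
    (Omega : measurableType d) (P : probability Omega R) (n : nat)
    (X : Omega -> 'cV[R]_n) (g : 'cV[R]_n -> R) :=
  [/\ measurable_fun [set: Omega] X,
      measurable_fun [set: 'cV[R]_n] g,
      forall t, 0 <= g t &
      forall B : set 'cV[R]_n, measurable B ->
        pushforward P X B = (\int[lebesgue_cv R n]_(t in B) (g t)%:E)%E].

Definition mutually_independent (R : realType) (d : measure_display)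
    (Omega : measurableType d) (P : probability Omega R) (I : finType)
    (X : I -> Omega -> R) :=
  forall (J : {set I}) (E : I -> set R), (forall i, measurable (E i)) ->
    P (\bigcap_(i in [set` J]) (X i @^-1` E i)) =
    (\prod_(i in J) P (X i @^-1` E i))%E.

Definition gaussian_matrix (R : realType) (d : measure_display)
    (Omega : measurableType d) (P : probability Omega R) (m n : nat)
    (A : Omega -> 'M[R]_(m, n)) :=
  [/\ forall i j, measurable_fun [set: Omega] (fun w => A w i j),
      forall i j (B : set R), measurable B ->
        pushforward P (fun w => A w i j) B = normal_prob 0 1 B &
      mutually_independent P (fun (ij : 'I_m * 'I_n) w => A w ij.1 ij.2)].

Definition Gamma (R : realType) (z : R) : R :=
  \int[lebesgue_measure]_(t in `]0, +oo[) (t `^ (z - 1) * expR (- t)).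

Definition t_pdf (R : realType) (l : nat) (nu : R) (Sigma : 'M[R]_l)
    (t : 'cV[R]_l) : R :=
  ((pi * nu) `^ (l%:R / 2))^-1 *
  (Gamma ((l%:R + nu) / 2) / Gamma (nu / 2)) *
  (\det Sigma) `^ (- (1 / 2)) *
  (1 + nu^-1 * (t^T *m invmx Sigma *m t) ord0 ord0) `^ (- ((l%:R + nu) / 2)).

Definition t_distributed (R : realType) (d : measure_display)
    (Omega : measurableType d) (P : probability Omega R) (l : nat)
    (X : Omega -> 'cV[R]_l) (nu : R) (Sigma : 'M[R]_l) :=
  has_pdf P X (t_pdf nu Sigma).

(* Main.v *)
Require Import Defs.
From HB Require Import structures.
From mathcomp Require Import all_boot all_order all_algebra.
From mathcomp Require Import all_classical all_reals all_analysis.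
From mathcomp Require Import measurable_realfun ring lra.

Set Implicit Arguments.
Unset Strict Implicit.
Unset Printing Implicit Defensive.

Import Order.TTheory GRing.Theory Num.Theory.
Import numFieldNormedType.Exports.

Local Open Scope classical_set_scope.
Local Open Scope ring_scope.

Local Notation pushforward_measure :=
  measure_function_pushforward__canonical__measure_function_Measure.

(* Put z = U^T (x* - p), of norm delta. The matrices B = U^T A and C = V^T A are
   the blocks of an orthogonal image of A, hence form a Gaussian matrix, and
   y_2* is the least-norm solution of B y = z. A rotation of the rows makes z a
   multiple of the last basis vector. Conditioning on the first row of B and
   rotating it onto the first axis of R^d forces the first coordinate of y to
   vanish, which leaves the same problem with one equation and one unknown
   less. After d_e - 1 steps a single row b ~ N(0, I_n) remains, y = delta
   b^T / |b|^2, and w = delta C b^T / |b|^2 is distributed as delta eta / |b| with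
   eta ~ N(0, I_m) independent of b. Integrating out b gives the density; its
   constant is the moment E |b|^m. *)

(** * Lebesgue measure under affine maps *)

Section lebesgue_affine.
Variable R : realType.
Local Notation leb := (@lebesgue_measure R).

(** [min_norm_point] is total, with value 0 on infeasible systems. Isometries fixing 0 carry this
    default along, so rank-deficient matrices are never discarded: the only Gaussian null event
    removed is that a single row b vanishes. The vector z is sent to the last axis, not the first,
    so that every row conditioned on before the final one has right-hand side 0. The moment of |b|
    is usually read off in polar coordinates. Since [lebesgue_cv] is an iterated product, it is
    obtained instead by comparing integrals on the half-line and on R^n against a test function
    invariant under inversion. The unknown integrals of the test function cancel between the
    exponents 0 and m, and convergence of the Gamma integrals comes out of the same identity. *)

Lemma measurable_affine (a b : R) :
  measurable_fun [set: measurableTypeR R]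
    (fun x => a * x + b : measurableTypeR R).
Proof.
by apply: measurable_funD => //; apply: measurable_funM.
Qed.

(** The scaled pushforward on the right gives every interval []u, v]] its length, which
    characterises Lebesgue measure. For a < 0 the preimage has its closed end on the left, which
    does not affect its length. *)
Lemma lebesgue_measure_affine (a b : R) (A : set R) : a != 0 ->
  measurable A ->
  (leb A = `|a|%:E * leb ((fun x => (a * x + b)%R) @^-1` A))%E.
Proof.
move=> a0 mA.
have a_ge0 : 0 <= `|a| by [].
pose mu := mscale (NngNum a_ge0)
  (pushforward_measure leb (measurable_affine a b)).
rewrite -[RHS]/(mu A); apply: lebesgue_measure_unique => //=.
move=> _ [[u v]] _ <-; rewrite /mu /mscale /= /pushforward.
have [ag0|al0] := ltP 0 a; last first.
  have {}al0 : a < 0 by rewrite lt_neqAle a0.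
  have -> : (fun x : R => a * x + b) @^-1` [set` `]u, v]%R] =
      [set` `[(v - b) / a, (u - b) / a[%R].
    apply/seteqP; split => x /=; rewrite !in_itv/=;
      by rewrite ler_ndivrMr// ltr_ndivlMr// lerBrDr ltrBlDr mulrC andbC.
  rewrite /= !lebesgue_measure_itv/= !lte_fin.
  rewrite ltr_nM2r ?invr_lt0// ltrD2r.
  case: ifPn => _; last by rewrite mule0.
  rewrite -EFinB -EFinM ltr0_norm//; congr (_%:E); field.
  exact: a0.
have -> : (fun x : R => a * x + b) @^-1` [set` `]u, v]%R] =
    [set` `](u - b) / a, (v - b) / a]%R].
  apply/seteqP; split => x /=; rewrite !in_itv/=;
    by rewrite ler_pdivlMr// ltr_pdivrMr// lerBrDr ltrBlDr mulrC.
rewrite /= !lebesgue_measure_itv/= !lte_fin.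
rewrite ltr_pM2r ?invr_gt0// ltrD2r.
case: ifPn => _; last by rewrite mule0.
rewrite -EFinB -EFinM gtr0_norm//; congr (_%:E); field.
exact: a0.
Qed.

Lemma ge0_integral_affine (a b : R) (f : R -> \bar R) : a != 0 ->
  measurable_fun [set: R] f -> (forall x, (0 <= f x)%E) ->
  (\int[leb]_x f (a * x + b)%R = (`|a|^-1)%:E * \int[leb]_x f x)%E.
Proof.
move=> a0 mf f0.
have a_ge0 : 0 <= `|a| by [].
have a_neq0 : `|a| != 0 by rewrite normr_eq0.
have -> : (\int[leb]_x f x = `|a|%:E * \int[leb]_x f (a * x + b)%R)%E.
  rewrite -[in RHS](@preimage_setT _ _ (fun x : R => a * x + b)).
  rewrite -[X in (_ * X)%E](@ge0_integral_pushforward _ _ _ _ _ _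
    (measurable_affine a b) leb)//.
  rewrite -(ge0_integral_mscale _ _ (NngNum a_ge0))//.
    exact: measurable_affine.
  by move=> mphi; apply: eq_measure_integral => A mA _;
    exact: lebesgue_measure_affine.
by rewrite muleA -EFinM mulVf// mul1e.
Qed.

End lebesgue_affine.

Lemma measurable_preimageT d d' (T : measurableType d) (T' : measurableType d')
    (f : T -> T') (S : set T') :
  measurable_fun setT f -> measurable S -> measurable (f @^-1` S).
Proof. by move=> mf mS; rewrite -[X in measurable X]setTI; exact: mf. Qed.

(** * Measurability of matrix operations *)

Section measurable_matrix.
Context (R : realType) {dT} {T : measurableType dT}.

Lemma measurable_fun_entry m n (F : T -> 'M[R]_(m, n)) i j :
  measurable_fun setT F -> measurable_fun setT (fun t => F t i j).
Proof.
by move=> mF; apply: (measurableT_comp (@measurable_entry R m n i j)).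
Qed.

Lemma measurable_mulmx m n p (F : T -> 'M[R]_(m, n)) (G : T -> 'M[R]_(n, p)) :
  measurable_fun setT F -> measurable_fun setT G ->
  measurable_fun setT (fun t => F t *m G t).
Proof.
move=> mF mG; apply: measurable_fun_mx => i j.
under eq_fun do rewrite mxE.
by apply: measurable_sum => k; apply: measurable_funM; exact: measurable_fun_entry.
Qed.

Lemma measurable_addmx m n (F G : T -> 'M[R]_(m, n)) :
  measurable_fun setT F -> measurable_fun setT G ->
  measurable_fun setT (fun t => F t + G t).
Proof.
move=> mF mG; apply: measurable_fun_mx => i j.
under eq_fun do rewrite mxE.
by apply: measurable_funD; exact: measurable_fun_entry.
Qed.

Lemma measurable_scalemx m n (f : T -> R) (G : T -> 'M[R]_(m, n)) :
  measurable_fun setT f -> measurable_fun setT G ->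
  measurable_fun setT (fun t => f t *: G t).
Proof.
move=> mf mG; apply: measurable_fun_mx => i j.
under eq_fun do rewrite mxE.
by apply: measurable_funM => //; exact: measurable_fun_entry.
Qed.

Lemma measurable_mxsub m n m' n' (f : 'I_m' -> 'I_m) (g : 'I_n' -> 'I_n)
    (F : T -> 'M[R]_(m, n)) :
  measurable_fun setT F -> measurable_fun setT (fun t => mxsub f g (F t)).
Proof.
move=> mF; apply: measurable_fun_mx => i j.
by under eq_fun do rewrite mxE; exact: measurable_fun_entry.
Qed.

Lemma measurable_trmx m n (F : T -> 'M[R]_(m, n)) :
  measurable_fun setT F -> measurable_fun setT (fun t => (F t)^T).
Proof.
move=> mF; apply: measurable_fun_mx => i j.
by under eq_fun do rewrite mxE; exact: measurable_fun_entry.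
Qed.

Lemma measurable_usubmx m1 m2 n (F : T -> 'M[R]_(m1 + m2, n)) :
  measurable_fun setT F -> measurable_fun setT (fun t => usubmx (F t)).
Proof.
move=> mF; apply: measurable_fun_mx => i j.
by under eq_fun do rewrite mxE; exact: measurable_fun_entry.
Qed.

Lemma measurable_dsubmx m1 m2 n (F : T -> 'M[R]_(m1 + m2, n)) :
  measurable_fun setT F -> measurable_fun setT (fun t => dsubmx (F t)).
Proof.
move=> mF; apply: measurable_fun_mx => i j.
by under eq_fun do rewrite mxE; exact: measurable_fun_entry.
Qed.

Lemma measurable_col_mx m1 m2 n (F : T -> 'M[R]_(m1, n))
    (G : T -> 'M[R]_(m2, n)) :
  measurable_fun setT F -> measurable_fun setT G ->
  measurable_fun setT (fun t => col_mx (F t) (G t)).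
Proof.
move=> mF mG; apply: measurable_fun_mx => i j.
by under eq_fun do rewrite mxE; case: (fintype.split i) => k; exact: measurable_fun_entry.
Qed.

Lemma measurable_det n (F : T -> 'M[R]_n) :
  measurable_fun setT F -> measurable_fun setT (fun t => \det (F t)).
Proof.
move=> mF; rewrite /determinant; apply: measurable_sum => s.
apply: measurable_funM => //; apply: measurable_prod => i _.
exact: measurable_fun_entry.
Qed.

End measurable_matrix.

(** * Tonelli and translation invariance on column vectors *)

Section lebesgue_cv_integral.
Variable R : realType.
Local Notation leb := (@lebesgue_measure R).
Local Notation lebn := (lebesgue_cv R).
Local Open Scope ereal_scope.

Section tonelli.
Variables (n : nat) (f : 'cV[R]_n.+1 -> \bar R).
Hypotheses (mf : measurable_fun setT f) (f0 : forall v, 0 <= f v).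

Let mfc : measurable_fun setT (f \o @cons_cv R n).
Proof. by apply: measurableT_comp => //; exact: measurable_cons_cv. Qed.

Let integral_prod : \int[lebn n.+1]_v f v =
  \int[(leb \x lebn n)]_z (f \o @cons_cv R n) z.
Proof.
rewrite -[in RHS](@preimage_setT _ _ (@cons_cv R n)).
exact: (ge0_integral_pushforward (@measurable_cons_cv R n) (leb \x lebn n)).
Qed.

Lemma ge0_integral_lebesgue_cvS :
  \int[lebn n.+1]_v f v = \int[leb]_x \int[lebn n]_v f (cons_cv (x, v)).
Proof. by rewrite integral_prod fubini_tonelli1// => z; exact: f0. Qed.

Lemma ge0_integral_lebesgue_cvS_swap :
  \int[lebn n.+1]_v f v = \int[lebn n]_v \int[leb]_x f (cons_cv (x, v)).
Proof. by rewrite integral_prod fubini_tonelli2// => z; exact: f0. Qed.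

End tonelli.

Lemma ge0_integral_lebesgue_cv_translation n (u : 'cV[R]_n)
    (f : 'cV[R]_n -> \bar R) :
  measurable_fun setT f -> (forall v, 0 <= f v) ->
  \int[lebn n]_v f (v + u)%R = \int[lebn n]_v f v.
Proof.
elim: n u f => [|n IH] u f mf f0.
  by apply: eq_integral => v _; congr f; rewrite [u]flatmx0 addr0.
have mcons := @measurable_cons_cv R n.
have madd u' : measurable_fun setT (fun v : 'cV[R]_n.+1 => v + u')%R.
  exact: measurable_addmx.
rewrite ge0_integral_lebesgue_cvS//; last exact: measurableT_comp.
have [a [w ->]] : exists a w, u = cons_cv (a, w).
  exists (usubmx (u : 'cV_(1 + n)) ord0 ord0), (dsubmx (u : 'cV_(1 + n))).
  apply: etrans (esym (@vsubmxK _ 1 n 1 u)) _.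
  congr (@col_mx _ 1 n 1 _ _); apply/matrixP => i j.
  by rewrite !mxE !ord1.
have consD x v : (cons_cv (x, v) + cons_cv (a, w))%R =
    cons_cv ((1 * x + a)%R, (v + w)%R) :> 'cV[R]_n.+1.
  rewrite /cons_cv/= mul1r [LHS](@add_col_mx _ 1 n 1).
  congr (@col_mx _ 1 n 1 _ _).
  by apply/matrixP => i j; rewrite !mxE.
transitivity (\int[leb]_x \int[lebn n]_v f (cons_cv ((1 * x + a)%R, v))).
  apply: eq_integral => x _.
  rewrite -[RHS](IH w)//.
    by apply: eq_integral => v _; rewrite consD.
  by do 2 apply: measurableT_comp => //; exact: measurable_pair1.
rewrite (@ge0_integral_affine _ 1 a (fun x => \int[lebn n]_v f (cons_cv (x, v))))//.
- by rewrite normr1 invr1 mul1e ge0_integral_lebesgue_cvS.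
- apply: (measurable_fun_fubini_tonelli_F (f \o @cons_cv R n)) => //.
  exact: measurableT_comp.
- by move=> x; exact: f0.
- by move=> x; apply: integral_ge0 => v _; exact: f0.
Qed.

End lebesgue_cv_integral.

(** * Linear change of variables on column vectors *)

Section lebesgue_cv_linear.
Variable R : realType.
Local Notation leb := (@lebesgue_measure R).
Local Notation lebn := (lebesgue_cv R).

Lemma measurable_mulmxl dT (T : measurableType dT) m n p (M : 'M[R]_(m, n))
    (F : T -> 'M[R]_(n, p)) :
  measurable_fun setT F -> measurable_fun setT (fun t => M *m F t).
Proof. by move=> mF; apply: measurable_mulmx. Qed.

Lemma measurable_mulmxr dT (T : measurableType dT) m n p (M : 'M[R]_(n, p))
    (F : T -> 'M[R]_(m, n)) :
  measurable_fun setT F -> measurable_fun setT (fun t => F t *m M).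
Proof. by move=> mF; apply: measurable_mulmx. Qed.

(** Stated as a property of one matrix, so that it can be proved for block triangular factors and
    passed to products. *)
Definition lebesgue_linear_change n (L : 'M[R]_n) :=
  forall f : 'cV[R]_n -> \bar R,
    measurable_fun setT f -> (forall v, (0 <= f v)%E) ->
    (\int[lebn n]_v f (L *m v) =
      (`|\det L|^-1)%:E * \int[lebn n]_v f v)%E.

Lemma lebesgue_linear_changeM n (L M : 'M[R]_n) :
  lebesgue_linear_change L -> lebesgue_linear_change M ->
  lebesgue_linear_change (L *m M).
Proof.
move=> hL hM f mf f0; rewrite det_mulmx normrM invfM EFinM -muleA muleCA -hL//.
rewrite -(hM (fun v => f (L *m v)))//.
  by apply: eq_integral => v _; rewrite mulmxA.
by apply: measurableT_comp => //; exact: measurable_mulmxl.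
Qed.

Lemma cons_cv_block n (a : R) (r : 'rV[R]_n) (c : 'cV[R]_n) (M : 'M[R]_n)
    (x : R) (v : 'cV[R]_n) :
  (block_mx a%:M r c M : 'M[R]_n.+1) *m cons_cv (x, v) =
  cons_cv ((a * x + (r *m v) ord0 ord0), (M *m v + x *: c)).
Proof.
rewrite /cons_cv/= [LHS](@mul_block_col _ 1 n 1 n 1).
congr (@col_mx _ 1 n 1 _ _); apply/matrixP => i j.
  by rewrite !mxE !ord1 big_ord1 !mxE eqxx mulr1n.
by rewrite !mxE big_ord1 !mxE addrC mulrC ord1.
Qed.

(** Once the first coordinate x is fixed, the shear translates the others by [x *: c], so
    translation invariance of the inner integral suffices. *)
Lemma lebesgue_linear_change_lower n (c : 'cV[R]_n) :
  lebesgue_linear_change (block_mx 1%:M 0 c 1%:M : 'M[R]_n.+1).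
Proof.
move=> f mf f0.
have mcons := @measurable_cons_cv R n.
rewrite (_ : \det _ = 1); last first.
  by rewrite [LHS](@det_lblock _ 1 n) !det1 mulr1.
rewrite normr1 invr1 mul1e ge0_integral_lebesgue_cvS//; last first.
  by apply: measurableT_comp => //; exact: measurable_mulmxl.
rewrite (ge0_integral_lebesgue_cvS mf f0); apply: eq_integral => x _.
rewrite -[RHS](ge0_integral_lebesgue_cv_translation (x *: c))//.
  by apply: eq_integral => v _; rewrite cons_cv_block !mul1mx mul0mx mul1r mxE addr0.
by apply: measurableT_comp => //; apply: measurableT_comp => //;
  exact: measurable_pair1.
Qed.

(** Tonelli is used in the other order: for fixed v the first coordinate undergoes an affine map of
    slope a, and the hypothesis on M handles the integral over v. *)
Lemma lebesgue_linear_change_upper n (a : R) (r : 'rV[R]_n) (M : 'M[R]_n) :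
  a != 0 -> lebesgue_linear_change M ->
  lebesgue_linear_change (block_mx a%:M r 0 M : 'M[R]_n.+1).
Proof.
move=> a0 hM f mf f0.
have mcons := @measurable_cons_cv R n.
have mfc : measurable_fun setT (f \o @cons_cv R n) by exact: measurableT_comp.
rewrite (_ : \det _ = a * \det M); last first.
  by rewrite [LHS](@det_ublock _ 1 n) det_scalar1.
rewrite normrM invfM EFinM -muleA.
rewrite ge0_integral_lebesgue_cvS_swap//; last first.
  by apply: measurableT_comp => //; exact: measurable_mulmxl.
have G0 v : (0 <= \int[leb]_x f (cons_cv (x, v)))%E.
  by apply: integral_ge0 => x _; exact: f0.
have mG : measurable_fun setT (fun v => \int[leb]_x f (cons_cv (x, v)))%E.
  apply: (measurable_fun_fubini_tonelli_G (f \o @cons_cv R n)) => //.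
  by move=> x; exact: f0.
rewrite ge0_integral_lebesgue_cvS_swap// -(hM _ mG)//.
rewrite -ge0_integralZl//; last first.
  by apply: (measurableT_comp mG); exact: measurable_mulmxl.
apply: eq_integral => v _.
rewrite -(ge0_integral_affine ((r *m v) ord0 ord0))//.
  by apply: eq_integral => x _; rewrite cons_cv_block scaler0 addr0.
by apply: measurableT_comp => //; apply: measurableT_comp => //;
  exact: measurable_pair2.
Qed.

(* Gaussian elimination of the first row and column; when the pivot vanishes,
   a column operation first replaces it with [r *m r^T]. *)
Lemma ge0_integral_lebesgue_cv_linear n (L : 'M[R]_n) :
  L \in unitmx -> lebesgue_linear_change L.
Proof.
elim: n L => [|n IH] L uL.
  move=> f mf f0; rewrite det_mx00 normr1 invr1 mul1e.
  by apply: eq_integral => v _; congr f; rewrite [RHS]flatmx0 [LHS]flatmx0.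
wlog pivot : L uL / (ulsubmx (L : 'M[R]_(1 + n)) ord0 ord0) != 0 => [wh|].
  have [p0|] := eqVneq ((ulsubmx (L : 'M[R]_(1 + n)) ord0 ord0)) 0; last exact: wh.
  pose r := ursubmx (L : 'M[R]_(1 + n)).
  pose E (c : 'cV[R]_n) : 'M[R]_n.+1 := block_mx 1%:M 0 c 1%:M.
  have EE : E r^T *m E (- r^T) = 1%:M.
    rewrite [LHS](@mulmx_block _ 1 n 1 n 1 n) !mul1mx !mulmx1 !mul0mx !mulmx0.
    by rewrite !addr0 add0r subrr [RHS](@scalar_mx_block _ 1 n).
  have uE c : E c \in unitmx.
    by rewrite unitmxE [\det _](@det_lblock _ 1 n) !det1 mulr1 unitr1.
  rewrite -[L]mulmx1 -EE mulmxA.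
  apply: lebesgue_linear_changeM; last exact: lebesgue_linear_change_lower.
  apply: wh; first by rewrite unitmx_mul uL uE.
  have r0 : r != 0.
    apply: contraTneq uL => r0; rewrite unitmxE.
    rewrite -[L](@submxK _ 1 n 1 n) -/r r0 [\det _](@det_lblock _ 1 n).
    rewrite (_ : ulsubmx _ = 0) ?det0 ?mul0r ?unitr0//.
    by apply/matrixP => i j; rewrite !ord1 [RHS]mxE.
  rewrite -[L](@submxK _ 1 n 1 n) [X in ulsubmx X](@mulmx_block _ 1 n 1 n 1 n).
  rewrite block_mxKul -/r mulmx1 mxE p0 add0r mxE.
  rewrite psumr_neq0; last by move=> i _; rewrite !mxE -expr2 sqr_ge0.
  have [i ri0] : exists i, r ord0 i != 0.
    apply/existsP; apply: contraR r0 => /existsPn r0.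
    by apply/eqP/rowP => j; rewrite [RHS]mxE; have /negPn/eqP := r0 j.
  apply/hasP; exists i; first by rewrite mem_index_enum.
  by rewrite /= [r^T i ord0]mxE -expr2 exprn_even_gt0.
pose a := (ulsubmx (L : 'M[R]_(1 + n)) ord0 ord0).
pose r := ursubmx (L : 'M[R]_(1 + n)).
pose c := dlsubmx (L : 'M[R]_(1 + n)).
pose M := drsubmx (L : 'M[R]_(1 + n)).
have a0 : a != 0 by [].
(* The lower right block of the second factor is the Schur complement of the pivot; it is invertible
   because L is, so the induction hypothesis applies to it. *)
have LE : L = (block_mx 1%:M 0 (a^-1 *: c) 1%:M : 'M[R]_n.+1) *m
              (block_mx a%:M r 0 (M - a^-1 *: (c *m r)) : 'M[R]_n.+1).
  rewrite [RHS](@mulmx_block _ 1 n 1 n 1 n) !mul1mx !mul0mx !addr0.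
  rewrite -[LHS](@submxK _ 1 n 1 n); congr (@block_mx _ 1 n 1 n _ _ _ _).
  - by apply/matrixP => i j; rewrite !ord1 [RHS]mxE eqxx mulr1n.
  - by rewrite mul_mx_scalar scalerA divff// scale1r.
  - by rewrite -scalemxAl addrC subrK.
rewrite LE; apply: lebesgue_linear_changeM; first exact: lebesgue_linear_change_lower.
apply: lebesgue_linear_change_upper => //; apply: IH.
move: uL; rewrite LE unitmx_mul => /andP[_].
by rewrite !unitmxE [\det _](@det_ublock _ 1 n) unitrM => /andP[].
Qed.

Lemma ge0_integral_lebesgue_cv_scale n (a : R) (f : 'cV[R]_n -> \bar R) :
  0 < a -> measurable_fun setT f -> (forall v, (0 <= f v)%E) ->
  (\int[lebn n]_v f (a *: v) = (a ^- n)%:E * \int[lebn n]_v f v)%E.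
Proof.
move=> a0 mf f0.
rewrite (_ : a ^- n = `|\det (a%:M : 'M[R]_n)|^-1); last first.
  by rewrite det_scalar ger0_norm// exprn_ge0// ltW.
rewrite -ge0_integral_lebesgue_cv_linear//.
  by apply: eq_integral => v _; rewrite mul_scalar_mx.
by rewrite unitmxE det_scalar unitrX// unitfE gt_eqF.
Qed.

End lebesgue_cv_linear.

(** * Gaussian matrices *)

Section ge0_integral_density.
Local Open Scope ereal_scope.
Context d (T : measurableType d) (R : realType).
Variables (mu nu : {measure set T -> \bar R}) (f : T -> R).
Hypotheses (mf : measurable_fun setT f) (f0 : forall x, (0 <= f x)%R).
Hypothesis nuE : forall S, measurable S -> nu S = \int[mu]_(x in S) (f x)%:E.

Import HBNNSimple.

Let ge0_integral_density_nnsfun (h : {nnsfun T >-> R}) :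
  \int[nu]_x (h x)%:E = \int[mu]_x ((h x)%:E * (f x)%:E).
Proof.
have mEf : measurable_fun setT (fun x => (f x)%:E) by exact/measurable_EFinP.
under [LHS]eq_integral do rewrite fimfunE -fsumEFin//.
rewrite [LHS]ge0_integral_fsum//; last 2 first.
  - by move=> r; exact/measurable_EFinP/measurableT_comp.
  - by move=> n x _; rewrite EFinM nnfun_muleindic_ge0.
under [RHS]eq_integral.
  move=> x xD; rewrite fimfunE -fsumEFin// muleC ge0_mule_fsumr; last first.
    by move=> r; rewrite EFinM nnfun_muleindic_ge0.
  over.
rewrite [RHS]ge0_integral_fsum//; last 2 first.
  - move=> r; apply: emeasurable_funM => //.
    by apply/measurable_EFinP; apply/measurableT_comp => //.
  - move=> n x _; apply: mule_ge0; first by rewrite lee_fin.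
    by rewrite EFinM nnfun_muleindic_ge0.
apply: eq_fsbigr => r _; rewrite integralZl_indic_nnsfun// integral_indic// setIT.
have mr : measurable (h @^-1` [set r]) by [].
under eq_integral do rewrite muleC EFinM -muleA.
(* A value r of h is known to be nonnegative only when it is attained; an empty fibre contributes 0
   to both sides. *)
have [hr0|hr0] := pselect (h @^-1` [set r] = set0).
  rewrite hr0 measure0 mule0; apply/esym/integral0_eq => x _.
  by rewrite indic0 mul0e mule0.
have r0 : (0 <= r)%R.
  have [x <-] : h @^-1` [set r] !=set0 by apply/set0P/eqP.
  exact: fun_ge0.
rewrite ge0_integralZl//; last 2 first.
  - apply: emeasurable_funM => //; exact/measurable_EFinP.
  - by move=> x _; rewrite mule_ge0// lee_fin.
congr (_ * _); rewrite nuE// integral_mkcond; apply: eq_integral => x _.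
by rewrite epatch_indic muleC.
Qed.

(** The density is known on sets only; the formula passes to simple functions by linearity and to h
    by monotone convergence. *)
Lemma ge0_integral_density (h : T -> \bar R) :
  measurable_fun setT h -> (forall x, 0 <= h x) ->
  \int[nu]_x h x = \int[mu]_x (h x * (f x)%:E).
Proof.
move=> mh h0; pose h_ := nnsfun_approx measurableT mh.
have mEf : measurable_fun setT (fun x => (f x)%:E) by exact/measurable_EFinP.
transitivity (limn (fun n => \int[nu]_x (h_ n x)%:E)).
  rewrite -monotone_convergence//=.
  - apply: eq_integral => x _; apply/esym/cvg_lim => //=.
    exact: cvg_nnsfun_approx.
  - by move=> n; apply/measurable_EFinP.
  - by move=> n x _; rewrite lee_fin.
  - by move=> x _ a b ab; rewrite lee_fin//; exact/lefP/nd_nnsfun_approx.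
transitivity (limn (fun n => \int[mu]_x ((h_ n x)%:E * (f x)%:E))).
  by congr (limn _); apply/funext => n; exact: ge0_integral_density_nnsfun.
rewrite -monotone_convergence//=.
- apply: eq_integral => x _; apply/cvg_lim => //=.
  apply: cvgeZr => //; exact: cvg_nnsfun_approx.
- by move=> n; apply: emeasurable_funM => //; exact/measurable_EFinP.
- by move=> n x _; rewrite mule_ge0// lee_fin.
- move=> x _ a b ab; apply: lee_wpmul2r; first by rewrite lee_fin.
  by rewrite lee_fin//; exact/lefP/nd_nnsfun_approx.
Qed.

End ge0_integral_density.

Section euclidean.
Variable R : realType.

Lemma dotv_mulmx n (u v : 'cV[R]_n) : dotv u v = (u^T *m v) ord0 ord0.
Proof. by rewrite /dotv mxE; apply: eq_bigr => i _; rewrite mxE. Qed.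

Lemma dotvC n (u v : 'cV[R]_n) : dotv u v = dotv v u.
Proof. by apply: eq_bigr => i _; rewrite mulrC. Qed.

Lemma dotvDl n (u v w : 'cV[R]_n) : dotv (u + v) w = dotv u w + dotv v w.
Proof. by rewrite !dotv_mulmx linearD /= mulmxDl mxE. Qed.

Lemma dotvDr n (u v w : 'cV[R]_n) : dotv w (u + v) = dotv w u + dotv w v.
Proof. by rewrite dotvC dotvDl ![dotv w _]dotvC. Qed.

Lemma dotvZl n a (u v : 'cV[R]_n) : dotv (a *: u) v = a * dotv u v.
Proof. by rewrite !dotv_mulmx linearZ /= -scalemxAl mxE. Qed.

Lemma dotvZr n a (u v : 'cV[R]_n) : dotv u (a *: v) = a * dotv u v.
Proof. by rewrite dotvC dotvZl dotvC. Qed.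

Lemma dotv_ge0 n (u : 'cV[R]_n) : 0 <= dotv u u.
Proof. by apply: sumr_ge0 => i _; rewrite -expr2 sqr_ge0. Qed.

Lemma dotv_eq0 n (u : 'cV[R]_n) : (dotv u u == 0) = (u == 0).
Proof.
apply/idP/eqP => [|->]; last by rewrite /dotv big1// => i _; rewrite mxE mul0r.
rewrite psumr_eq0; last by move=> i _; rewrite -expr2 sqr_ge0.
move=> /allP u0; apply/matrixP => i j; rewrite ord1 [RHS]mxE.
by have := u0 i (mem_index_enum i); rewrite /= -expr2 sqrf_eq0 => /eqP.
Qed.

Lemma dotv_mull n m (M : 'M[R]_(m, n)) (u : 'cV[R]_m) (v : 'cV[R]_n) :
  dotv u (M *m v) = dotv (M^T *m u) v.
Proof. by rewrite !dotv_mulmx trmx_mul trmxK mulmxA. Qed.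

Lemma enorm_sqr n (u : 'cV[R]_n) : enorm u ^+ 2 = dotv u u.
Proof. by rewrite /enorm sqr_sqrtr// dotv_ge0. Qed.

Lemma enorm_ge0 n (u : 'cV[R]_n) : 0 <= enorm u.
Proof. exact: sqrtr_ge0. Qed.

Lemma enorm_eq0 n (u : 'cV[R]_n) : (enorm u == 0) = (u == 0).
Proof. by rewrite -dotv_eq0 -enorm_sqr sqrf_eq0. Qed.

Lemma ler_enorm n (u v : 'cV[R]_n) :
  (enorm u <= enorm v) = (dotv u u <= dotv v v).
Proof. by rewrite /enorm ler_sqrt// dotv_ge0. Qed.

End euclidean.

Section boxes.
Variable R : realType.

Definition mxbox m n (E : 'I_m -> 'I_n -> set R) : set 'M[R]_(m, n) :=
  [set M | forall i j, E i j (M i j)].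

Lemma measurable_mxbox m n (E : 'I_m -> 'I_n -> set R) :
  (forall i j, measurable (E i j)) -> measurable (mxbox E).
Proof.
move=> mE.
have -> : mxbox E = \bigcap_(i in [set: 'I_m]) \bigcap_(j in [set: 'I_n])
    ((fun M : 'M[R]_(m, n) => M i j) @^-1` E i j).
  by apply/seteqP; split => M /= h i *; [move=> j _; exact: h|exact: h].
apply: fin_bigcap_measurable => // i _; apply: fin_bigcap_measurable => // j _.
by rewrite -[X in measurable X]setTI; exact: measurable_entry.
Qed.

Lemma mxbox_set1 m n (M : 'M[R]_(m, n)) :
  [set M] = mxbox (fun i j => [set M i j]).
Proof. by apply/seteqP; split => [_ ->//|N NM]; apply/matrixP; exact: NM. Qed.

Lemma measurable_mx_set1 m n (M : 'M[R]_(m, n)) : measurable [set M].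
Proof. by rewrite mxbox_set1; exact: measurable_mxbox. Qed.

(** Boxes are stable under intersection, and they generate the sigma-algebra because an entry
    cylinder is a box whose other sides are [setT]. *)
Lemma mx_measure_unique m n (mu nu : {measure set 'M[R]_(m, n) -> \bar R}) :
  (mu setT < +oo)%E ->
  (forall E, (forall i j, measurable (E i j)) -> mu (mxbox E) = nu (mxbox E)) ->
  forall S, measurable S -> mu S = nu S.
Proof.
move=> muT munu S mS.
pose G : set (set 'M[R]_(m, n)) :=
  [set B | exists2 E, (forall i j, measurable (E i j)) & B = mxbox E].
have boxT : mxbox (fun _ _ => setT) = setT :> set 'M[R]_(m, n).
  exact/seteqP.
apply: (measure_unique G (fun=> setT)) => //.
- apply/seteqP; split.
    apply: sub_sigma_algebra2 => _ [i [j [C [mC ->]]]].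
    exists (fun i' j' => if (i' == i) && (j' == j) then C else setT).
      by move=> i' j'; case: ifP.
    apply/seteqP; split => M /=.
      by move=> CM i' j'; case: ifP => // /andP[/eqP-> /eqP->].
    by move=> /(_ i j); rewrite !eqxx.
  apply: smallest_sub; first exact: sigma_algebra_measurable.
  by move=> _ [E mE ->]; exact: measurable_mxbox.
- move=> _ _ [E mE ->] [F mF ->]; exists (fun i j => E i j `&` F i j).
    by move=> i j; exact: measurableI.
  apply/seteqP; split => M /=; first by move=> [ME MF] i j; split.
  by move=> MEF; split => i j; have [] := MEF i j.
- by move=> _; exists (fun _ _ => setT).
- by rewrite bigcup_const//; exists 0%N.
- by move=> _ [E mE ->]; exact: munu.
Qed.

End boxes.

Section gauss_cv.
Variable R : realType.
Local Notation leb := (@lebesgue_measure R).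
Local Notation lebn := (lebesgue_cv R).
Local Open Scope ereal_scope.

Lemma measurable_prod_entries n (h : 'I_n -> R -> R) :
  (forall i, measurable_fun setT (h i)) ->
  measurable_fun setT (fun v : 'cV[R]_n => (\prod_(i < n) h i (v i ord0))%R).
Proof.
move=> mh; apply: measurable_prod => i _.
by apply: (measurableT_comp (mh i)); exact: measurable_entry.
Qed.

Lemma ge0_integral_lebesgue_cv_prod n (h : 'I_n -> R -> R) :
  (forall i, measurable_fun setT (h i)) -> (forall i x, (0 <= h i x)%R) ->
  \int[lebn n]_v (\prod_(i < n) h i (v i ord0))%:E =
  \prod_(i < n) \int[leb]_x (h i x)%:E.
Proof.
elim: n h => [|n IH] h mh h0.
  rewrite big_ord0 /=; under eq_integral do rewrite big_ord0.
  by rewrite integral_cst//= diracT mul1e.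
rewrite ge0_integral_lebesgue_cvS; first last.
- by move=> v; rewrite lee_fin prodr_ge0.
- by apply/measurable_EFinP; exact: measurable_prod_entries.
rewrite big_ord_recl -ge0_integralZr//; last 3 first.
- by apply/measurable_EFinP; exact: mh.
- by move=> x _; rewrite lee_fin.
- by apply: prode_ge0 => i _; apply: integral_ge0 => x _; rewrite lee_fin.
apply: eq_integral => x _; rewrite -IH// -ge0_integralZl//; last 3 first.
- apply/measurable_EFinP.
  exact: (@measurable_prod_entries n (fun i => h (lift ord0 i))).
- by move=> v _; rewrite lee_fin prodr_ge0.
- by rewrite lee_fin.
apply: eq_integral => v _; rewrite -EFinM; congr (_%:E).
have [cx cv] : cons_cv (x, v) ord0 ord0 = x /\
    forall i, cons_cv (x, v) (lift ord0 i) ord0 = v i ord0.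
  have := cons_cvK (x, v); rewrite /uncons_cv => -[-> cv]; split=> // i.
  by move/colP: cv => /(_ i); rewrite mxE.
by rewrite big_ord_recl cx; congr (_ * _)%R; apply: eq_bigr => i _; rewrite cv.
Qed.

Definition gauss_pdf n (v : 'cV[R]_n) : R :=
  (\prod_(i < n) normal_pdf 0 1 (v i ord0))%R.

Lemma gauss_pdf_ge0 n (v : 'cV[R]_n) : (0 <= gauss_pdf v)%R.
Proof. by apply: prodr_ge0 => i _; exact: normal_pdf_ge0. Qed.

Lemma measurable_gauss_pdf n : measurable_fun setT (@gauss_pdf n).
Proof.
apply: (@measurable_prod_entries n (fun=> normal_pdf 0 1)) => i.
exact: measurable_normal_pdf.
Qed.

(** Exhibits the density as a function of [dotv v v] alone, the source of rotation invariance. *)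
Lemma gauss_pdfE n (v : 'cV[R]_n) :
  gauss_pdf v = (normal_peak 1 ^+ n * expR (- (dotv v v / 2)))%R.
Proof.
rewrite /gauss_pdf /dotv mulr_suml -sumrN expR_sum.
have -> : (normal_peak 1 ^+ n = \prod_(i < n) normal_peak 1 :> R)%R.
  by rewrite prodr_const card_ord.
rewrite -big_split/=.
apply: eq_bigr => i _; rewrite /normal_pdf oner_eq0 /normal_fun.
by rewrite subr0 expr1n -expr2 mulNr.
Qed.

Definition gauss_cv n (S : set 'cV[R]_n) : \bar R :=
  \int[lebn n]_(v in S) (gauss_pdf v)%:E.

Let gauss_cv0 n : gauss_cv (set0 : set 'cV[R]_n) = 0.
Proof. by rewrite /gauss_cv integral_set0. Qed.

Let gauss_cv_ge0 n (S : set 'cV[R]_n) : 0 <= gauss_cv S.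
Proof. by apply: integral_ge0 => v _; rewrite lee_fin gauss_pdf_ge0. Qed.

Let gauss_cv_sigma_additive n : semi_sigma_additive (@gauss_cv n).
Proof.
apply: semi_sigma_additive_nng_induced.
  by apply/measurable_EFinP; exact: measurable_gauss_pdf.
by move=> v; rewrite lee_fin gauss_pdf_ge0.
Qed.

HB.instance Definition _ n := isMeasure.Build _ _ _ (@gauss_cv n)
  (@gauss_cv0 n) (@gauss_cv_ge0 n) (@gauss_cv_sigma_additive n).

Lemma gauss_cv_box n (E : 'I_n -> set R) : (forall i, measurable (E i)) ->
  gauss_cv [set v : 'cV[R]_n | forall i, E i (v i ord0)] =
  \prod_(i < n) normal_prob 0 1 (E i).
Proof.
move=> mE; rewrite /gauss_cv integral_mkcond.
transitivity (\int[lebn n]_v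
  (\prod_(i < n) (normal_pdf 0 1 (v i ord0) * \1_(E i) (v i ord0)))%R%:E).
  apply: eq_integral => v _; rewrite patchE big_split /=.
  have [vE|vE] := asboolP (forall i, E i (v i ord0)).
    rewrite ifT ?inE//; congr (_%:E).
    by rewrite [X in (_ * X)%R]big1 ?mulr1// => i _; rewrite indicE mem_set.
  rewrite ifF; last by apply/negbTE; rewrite notin_setE.
  move/existsNP: vE => [i vE].
  by rewrite [X in (_ * X)%R](bigD1 i)//= indicE memNset// mul0r mulr0.
rewrite (ge0_integral_lebesgue_cv_prod
  (h := fun i x => (normal_pdf 0 1 x * \1_(E i) x)%R)).
- apply: eq_bigr => i _; rewrite /normal_prob [RHS]integral_mkcond.
  by apply: eq_integral => x _; rewrite epatch_indic EFinM.
- move=> i; apply: measurable_funM; first exact: measurable_normal_pdf.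
  exact: measurable_indic.
- by move=> i x; rewrite mulr_ge0// normal_pdf_ge0.
Qed.

Let gauss_cv_setT n : gauss_cv [set: 'cV[R]_n] = 1.
Proof.
have <- : [set v : 'cV[R]_n | forall i, [set: R] (v i ord0)] = setT.
  exact/seteqP.
rewrite (@gauss_cv_box n (fun=> setT))// big1// => i _.
exact: probability_setT.
Qed.

HB.instance Definition _ n :=
  @Measure_isProbability.Build _ _ R (@gauss_cv n) (@gauss_cv_setT n).

Lemma ge0_integral_gauss_cv n (h : 'cV[R]_n -> \bar R) :
  measurable_fun setT h -> (forall v, 0 <= h v) ->
  \int[@gauss_cv n]_v h v = \int[lebn n]_v (h v * (gauss_pdf v)%:E).
Proof.
apply: ge0_integral_density => //; first exact: measurable_gauss_pdf.
by move=> v; exact: gauss_pdf_ge0.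
Qed.

End gauss_cv.

Section gauss_mx.
Variable R : realType.
Local Open Scope ereal_scope.

Definition mx_of_cv m n (v : 'cV[R]_(m * n)) : 'M[R]_(m, n) := vec_mx v^T.

Lemma measurable_mx_of_cv m n : measurable_fun setT (@mx_of_cv m n).
Proof.
apply: measurable_fun_mx => i j.
rewrite (_ : (fun _ => _) =
  fun v : 'cV[R]_(m * n) => v (mxvec_index i j) ord0).
  exact: measurable_entry.
by apply/funext => v; rewrite !mxE.
Qed.

(** Transported from vectors of length [m * n], so that isometries of the matrix space reduce to the
    vector case. *)
Definition gauss_mx m n : set 'M[R]_(m, n) -> \bar R :=
  pushforward (@gauss_cv R (m * n)) (@mx_of_cv m n).

HB.instance Definition _ m n := Measure.copy (@gauss_mx m n)
  (pushforward_measure (@gauss_cv R (m * n)) (@measurable_mx_of_cv m n)).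

Let gauss_mx_setT m n : @gauss_mx m n setT = 1.
Proof. by rewrite /gauss_mx /pushforward preimage_setT probability_setT. Qed.

HB.instance Definition _ m n :=
  @Measure_isProbability.Build _ _ R (@gauss_mx m n) (@gauss_mx_setT m n).

Lemma gauss_mx_box m n (E : 'I_m -> 'I_n -> set R) :
  (forall i j, measurable (E i j)) ->
  gauss_mx (mxbox E) = \prod_(ij : 'I_m * 'I_n) normal_prob 0 1 (E ij.1 ij.2).
Proof.
move=> mE.
have [g gK Kg] := curry_mxvec_bij m n.
rewrite -[LHS]/(gauss_cv (@mx_of_cv m n @^-1` mxbox E)).
have -> : @mx_of_cv m n @^-1` mxbox E =
    [set v | forall k, E (g k).1 (g k).2 (v k ord0)].
  apply/seteqP; split => v /=.
    move=> vE k; have := vE (g k).1 (g k).2; rewrite !mxE.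
    by have := Kg k; case: (g k) => i j /= ->.
  move=> vE i j; have := vE (mxvec_index i j); rewrite !mxE.
  by have := gK (i, j); rewrite /= => ->.
rewrite (@gauss_cv_box _ _ (fun k => E (g k).1 (g k).2))//.
rewrite [RHS](reindex g)//=; exists (uncurry (@mxvec_index m n)) => k _.
  exact: Kg.
exact: gK.
Qed.

Lemma gauss_mx_unique m n (mu : {measure set 'M[R]_(m, n) -> \bar R}) :
  (forall E, (forall i j, measurable (E i j)) -> mu (mxbox E) =
    \prod_(ij : 'I_m * 'I_n) normal_prob 0 1 (E ij.1 ij.2)) ->
  forall S, measurable S -> mu S = gauss_mx S.
Proof.
move=> muE S mS; apply/esym/mx_measure_unique => //.
  by rewrite [X in (X < _)%E](@probability_setT _ _ _ (@gauss_mx m n)) ltry.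
by move=> E mE; rewrite muE//; exact: gauss_mx_box.
Qed.

(** Independence over the full index set gives every box the product of its side probabilities, and
    boxes determine the law. From here on the fixed measure [gauss_mx] replaces the random
    matrix. *)
Lemma gaussian_matrix_law d (Omega : measurableType d)
    (P : probability Omega R) m n (A : Omega -> 'M[R]_(m, n)) :
  gaussian_matrix P A ->
  forall S, measurable S -> P (A @^-1` S) = gauss_mx S.
Proof.
move=> [mA lawA indA] S mS.
have mAf : measurable_fun setT A by exact: measurable_fun_mx.
apply: (@gauss_mx_unique m n (pushforward_measure P mAf)) => // E mE.
rewrite -[LHS]/(P (A @^-1` mxbox E)).
have := indA (finset.setTfor _) (fun ij => E ij.1 ij.2) (fun ij => mE _ _).
rewrite (_ : \bigcap_(i in _) _ = A @^-1` mxbox E); last first.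
  apply/seteqP; split => w /=; first by move=> AE i j; apply: (AE (i, j)); rewrite /= finset.in_setT.
  by move=> AE [i j] _ /=; exact: AE.
move=> ->; apply: eq_big => [ij|ij _]; first by rewrite finset.in_setT.
exact: lawA.
Qed.

Lemma gauss_mx_trmx m n (S : set 'M[R]_(n, m)) : measurable S ->
  gauss_mx [set M : 'M[R]_(m, n) | S M^T] = gauss_mx S.
Proof.
have mtr : measurable_fun [set: 'M[R]_(m, n)] (fun M => M^T).
  exact: measurable_trmx.
move=> mS; apply: (@gauss_mx_unique n m
  (pushforward_measure (@gauss_mx m n) mtr)) => // E mE.
rewrite -[LHS]/(gauss_mx ((fun M : 'M[R]_(m, n) => M^T) @^-1` mxbox E)).
have -> : (fun M : 'M[R]_(m, n) => M^T) @^-1` mxbox E =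
    mxbox (fun i j => E j i).
  by apply/seteqP; split => M /= h i j; have := h j i; rewrite mxE.
rewrite gauss_mx_box//.
rewrite (reindex (fun ij : 'I_n * 'I_m => (ij.2, ij.1)))//=.
by exists (fun ij => (ij.2, ij.1)) => -[].
Qed.

(** Independence of the two row blocks in Fubini form, used to condition on the top rows. On a box
    the product over all entries splits at row a. *)
Lemma gauss_mx_col_mx a c n (S : set 'M[R]_(a + c, n)) : measurable S ->
  gauss_mx S =
  \int[@gauss_mx a n]_b gauss_mx [set C : 'M[R]_(c, n) | S (col_mx b C)].
Proof.
have mcol : measurable_fun [set: 'M[R]_(a, n) * 'M[R]_(c, n)]
    (fun bc => col_mx bc.1 bc.2) by exact: measurable_col_mx.
move=> mS.
transitivity ((@gauss_mx a n \x @gauss_mx c n)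
    ((fun bc => col_mx bc.1 bc.2) @^-1` S)); last first.
  rewrite /product_measure1; apply: eq_integral => b _; congr gauss_mx.
  by apply/seteqP; split => C; rewrite /xsection /= inE.
apply/esym; apply: (@gauss_mx_unique (a + c) n
  (pushforward_measure (@gauss_mx a n \x @gauss_mx c n) mcol)) => // E mE.
rewrite -[LHS]/((@gauss_mx a n \x @gauss_mx c n)
  ((fun bc => col_mx bc.1 bc.2) @^-1` mxbox E)).
have -> : (fun bc => col_mx bc.1 bc.2) @^-1` mxbox E =
  mxbox (fun i => E (lshift c i)) `*` mxbox (fun i => E (rshift a i)).
  apply/seteqP; split => -[b C] /=.
    move=> h; split => i j; [have := h (lshift c i) j|have := h (rshift a i) j].
      by rewrite col_mxEu.
    by rewrite col_mxEd.
  move=> [hb hC] i j; case: (split_ordP i) => k ->.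
    by rewrite col_mxEu; exact: hb.
  by rewrite col_mxEd; exact: hC.
transitivity (gauss_mx (mxbox (fun i => E (lshift c i))) *
              gauss_mx (mxbox (fun i => E (rshift a i)))).
  by apply: product_measure1E; exact: measurable_mxbox.
rewrite !gauss_mx_box//.
rewrite -(pair_big xpredT xpredT (fun i j => normal_prob 0 1 (E (lshift c i) j)))/=.
rewrite -(pair_big xpredT xpredT (fun i j => normal_prob 0 1 (E (rshift a i) j)))/=.
rewrite -(pair_big xpredT xpredT (fun i j => normal_prob 0 1 (E i j)))/=.
by rewrite big_split_ord.
Qed.

Lemma gauss_mx_dsubmx a c n (S : set 'M[R]_(c, n)) : measurable S ->
  gauss_mx [set M : 'M[R]_(a + c, n) | S (dsubmx M)] = gauss_mx S.
Proof.
move=> mS; rewrite gauss_mx_col_mx; last first.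
  exact: (measurable_preimageT (measurable_dsubmx (@measurable_id _ _ setT))).
under eq_integral.
  move=> b _; rewrite (_ : [set C | _] = S); last first.
    by apply/seteqP; split => C /=; rewrite col_mxKd.
  over.
rewrite integral_cst//.
by rewrite [X in _ * X](@probability_setT _ _ _ (@gauss_mx a n)) mule1.
Qed.

Lemma gauss_mx_usubmx a c n (S : set 'M[R]_(a, n)) : measurable S ->
  gauss_mx [set M : 'M[R]_(a + c, n) | S (usubmx M)] = gauss_mx S.
Proof.
move=> mS; rewrite gauss_mx_col_mx; last first.
  exact: (measurable_preimageT (measurable_usubmx (@measurable_id _ _ setT))).
rewrite -[in RHS](setIT S) -[RHS]integral_indic//.
apply: eq_integral => b _; rewrite indicE; have [bS|bS] := boolP (b \in S).
  rewrite (_ : [set C | _] = setT) ?probability_setT//.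
  by apply/seteqP; split => // C _ /=; rewrite col_mxKu; exact/set_mem.
rewrite (_ : [set C | _] = set0) ?measure0//.
apply/seteqP; split => // C /=; rewrite col_mxKu => Sb.
by move: bS; rewrite mem_set.
Qed.

Lemma gauss_mx_rsubmx n a c (S : set 'M[R]_(n, c)) : measurable S ->
  gauss_mx [set M : 'M[R]_(n, a + c) | S (rsubmx M)] = gauss_mx S.
Proof.
have -> : [set M : 'M[R]_(n, a + c) | S (rsubmx M)] =
    [set M | [set N | [set C : 'M[R]_(c, n) | S C^T] (dsubmx N)] M^T].
  by apply/seteqP; split => M /=; rewrite trmx_dsub trmxK.
move=> mS.
have mS' : measurable [set C : 'M[R]_(c, n) | S C^T].
  exact: (measurable_preimageT (measurable_trmx (@measurable_id _ _ setT))).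
rewrite gauss_mx_trmx; last first.
  exact: (measurable_preimageT (measurable_dsubmx (@measurable_id _ _ setT))).
by rewrite gauss_mx_dsubmx// gauss_mx_trmx.
Qed.

Lemma gauss_mx_cv n (S : set 'cV[R]_n) : measurable S ->
  gauss_mx S = gauss_cv S.
Proof.
move=> mS; apply/esym/(@gauss_mx_unique n 1 (@gauss_cv R n)) => // E mE.
rewrite (_ : mxbox E = [set v | forall i, E i ord0 (v i ord0)]); last first.
  by apply/seteqP; split => v /= h i; [exact: h|move=> j; rewrite ord1].
rewrite [LHS](@gauss_cv_box _ _ (fun i => E i ord0))//.
rewrite -(pair_big xpredT xpredT (fun i j => normal_prob 0 1 (E i j)))/=.
by apply: eq_bigr => i _; rewrite big_ord1.
Qed.

(** The linear change of variables yields the factor [|\det L|^-1], the same for every set; testing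
    it on the whole space, of mass 1 on both sides, shows that it equals 1. *)
Lemma gauss_cv_isometry n (L : 'M[R]_n) (S : set 'cV[R]_n) :
  (forall v, dotv (L *m v) (L *m v) = dotv v v) -> measurable S ->
  gauss_cv [set v | S (L *m v)] = gauss_cv S.
Proof.
move=> Liso mS.
have mL : measurable_fun setT (fun v : 'cV[R]_n => L *m v).
  exact: measurable_mulmxl.
(* A vector v in the kernel of L satisfies [dotv v v = 0]. *)
have uL : L \in unitmx.
  rewrite -unitmx_tr -row_free_unit -kermx_eq0; apply/eqP/row_matrixP => i.
  rewrite row0; apply: trmx_inj; rewrite trmx0.
  set v := (row i _)^T.
  have Lv0 : L *m v = 0%R.
    by rewrite /v -{1}[L]trmxK -trmx_mul -row_mul mulmx_ker row0 trmx0.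
  by apply/eqP; rewrite -dotv_eq0 -Liso Lv0 dotv_eq0.
have scal T : measurable T ->
    gauss_cv [set v | T (L *m v)] = (`|\det L|^-1)%:E * gauss_cv T.
  move=> mT; rewrite /gauss_cv integral_mkcond [in RHS]integral_mkcond.
  have mTpdf : measurable_fun setT ((fun v => (gauss_pdf v)%:E) \_ T).
    apply/(measurable_restrictT _ mT)/measurable_funTS/measurable_EFinP.
    exact: measurable_gauss_pdf.
  have Tpdf0 v : 0 <= ((fun v => (gauss_pdf v)%:E) \_ T) v.
    by rewrite patchE; case: ifP => // _; rewrite lee_fin gauss_pdf_ge0.
  rewrite -(ge0_integral_lebesgue_cv_linear uL mTpdf Tpdf0).
  apply: eq_integral => v _; rewrite !patchE.
  rewrite (_ : (v \in _) = (L *m v \in T)); last by apply/idP/idP; rewrite !inE.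
  by rewrite !gauss_pdfE Liso.
have := scal setT measurableT.
rewrite (_ : [set v | _] = setT) ?probability_setT; last exact/seteqP.
by rewrite mule1 scal// => <-; rewrite mul1e.
Qed.

(** [\tr (M *m M^T)] is the squared Frobenius norm, that is [dotv v v] for the vectorised matrix, on
    which F acts as [(lin_mx F)^T]. *)
Lemma gauss_mx_isometry m n (F : {linear 'M[R]_(m, n) -> 'M[R]_(m, n)})
    (S : set 'M[R]_(m, n)) :
  (forall M, \tr (F M *m (F M)^T) = \tr (M *m M^T)) -> measurable S ->
  gauss_mx [set M | S (F M)] = gauss_mx S.
Proof.
move=> Fiso mS.
rewrite /gauss_mx /pushforward.
have mC : measurable_fun setT (@mx_of_cv m n) by exact: measurable_mx_of_cv.
have normE (v : 'cV[R]_(m * n)) :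
    dotv v v = \tr (mx_of_cv v *m (mx_of_cv v)^T).
  rewrite /dotv /mxtrace.
  under [RHS]eq_bigr do rewrite mxE.
  rewrite pair_big/= (reindex (uncurry (@mxvec_index m n)))/=.
    by apply: eq_bigr => -[i j] _; rewrite /mx_of_cv !mxE.
  by have [g gK Kg] := curry_mxvec_bij m n; exists g => x _; [exact: gK|exact: Kg].
have LF (v : 'cV[R]_(m * n)) : mx_of_cv ((lin_mx F)^T *m v) = F (mx_of_cv v).
  by rewrite /mx_of_cv trmx_mul trmxK -{1}[v^T]vec_mxK mul_vec_lin mxvecK.
rewrite -[RHS](@gauss_cv_isometry _ (lin_mx F)^T).
- by congr gauss_cv; apply/seteqP; split => v /=; rewrite LF.
- by move=> v; rewrite !normE LF Fiso.
- exact: (measurable_preimageT mC).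
Qed.

Lemma gauss_mx_mull m n (O : 'M[R]_m) (S : set 'M[R]_(m, n)) :
  O^T *m O = 1%:M -> measurable S ->
  gauss_mx [set M | S (O *m M)] = gauss_mx S.
Proof.
move=> OO mS; apply: (gauss_mx_isometry (F := mulmx O)) => // M /=.
by rewrite trmx_mul !mulmxA mxtrace_mulC !mulmxA OO mul1mx.
Qed.

Lemma gauss_mx_mulr m n (O : 'M[R]_n) (S : set 'M[R]_(m, n)) :
  O *m O^T = 1%:M -> measurable S ->
  gauss_mx [set M | S (M *m O)] = gauss_mx S.
Proof.
move=> OO mS; apply: (gauss_mx_isometry (F := mulmxr O)) => // M /=.
by rewrite trmx_mul !mulmxA -(mulmxA M) OO mulmx1.
Qed.

End gauss_mx.

(** * Least-norm solutions of linear systems *)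

Section min_norm_solution.
Variable R : realType.

Definition solutions k d (z : 'cV[R]_k) (B : 'M[R]_(k, d)) : set 'cV[R]_d :=
  [set y | B *m y = z].

(** The midpoint of two minimisers is again a solution, so its norm is at least theirs; the
    parallelogram law then forces |y - y'|^2 <= 0. *)
Lemma min_norm_solution_unique k d (z : 'cV[R]_k) (B : 'M[R]_(k, d)) y y' :
  min_norm_points (solutions z B) y -> min_norm_points (solutions z B) y' ->
  y = y'.
Proof.
move=> [Sy miny] [Sy' miny'].
have := miny' _ Sy; have := miny _ Sy'; rewrite !ler_enorm => yy' y'y.
have Sm : solutions z B (2^-1 *: (y + y')).
  rewrite /solutions/= -scalemxAr mulmxDr Sy Sy'.
  by apply/matrixP => i j; rewrite !mxE; lra.
have := miny _ Sm; rewrite ler_enorm dotvZl dotvZr dotvDl !dotvDr.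
rewrite (dotvC y' y) => ym.
apply/eqP; rewrite -subr_eq0 -dotv_eq0 eq_le dotv_ge0 andbT.
rewrite -scaleN1r !(dotvDl, dotvDr, dotvZl, dotvZr) (dotvC y' y).
lra.
Qed.

Lemma min_norm_solutionE k d (z : 'cV[R]_k) (B : 'M[R]_(k, d)) y :
  min_norm_points (solutions z B) y -> min_norm_point (solutions z B) = y.
Proof.
move=> hy; apply: xget_unique => // y' hy'.
exact: min_norm_solution_unique hy' hy.
Qed.

(** Any other solution differs from [B^T *m u] by an element of the kernel of B, which is orthogonal
    to the row space; Pythagoras concludes. *)
Lemma min_norm_row_space k d (z : 'cV[R]_k) (B : 'M[R]_(k, d)) u :
  B *m (B^T *m u) = z -> min_norm_point (solutions z B) = B^T *m u.
Proof.
move=> Bu; apply: min_norm_solutionE; split=> // y Sy.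
pose e := y - B^T *m u.
have Be : B *m e = 0 by rewrite mulmxBr Bu Sy subrr.
have yE : y = e + B^T *m u by rewrite subrK.
move: e Be yE => e Be ->; rewrite ler_enorm !(dotvDl, dotvDr).
have -> : dotv e (B^T *m u) = 0.
  by rewrite dotvC -dotv_mull Be dotv_mulmx mulmx0 mxE.
have -> : dotv (B^T *m u) e = 0.
  by rewrite -dotv_mull Be dotv_mulmx mulmx0 mxE.
by rewrite addr0 add0r lerDr dotv_ge0.
Qed.

(** Also covers systems without a minimiser: both sides are then the default 0, which is the purpose
    of [f 0 = 0]. *)
Lemma min_norm_point_isometry k k' d d' (z : 'cV[R]_k) (B : 'M[R]_(k, d))
    (z' : 'cV[R]_k') (B' : 'M[R]_(k', d')) (f : 'cV[R]_d -> 'cV[R]_d') :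
  f 0 = 0 -> (forall y, dotv (f y) (f y) = dotv y y) ->
  solutions z' B' = f @` solutions z B ->
  min_norm_point (solutions z' B') = f (min_norm_point (solutions z B)).
Proof.
move=> f0 fiso S'E.
have S'f y : solutions z B y -> solutions z' B' (f y).
  by rewrite S'E => Sy; exists y.
have [[y hy]|nomin] := pselect (exists y, min_norm_points (solutions z B) y).
  rewrite (min_norm_solutionE hy); apply: min_norm_solutionE.
  have [Sy miny] := hy; split; first exact: S'f.
  rewrite S'E => _ [x Sx <-]; rewrite ler_enorm !fiso -ler_enorm; exact: miny.
rewrite /min_norm_point (@xgetPN _ _ (min_norm_points (solutions z B))).
  rewrite f0; apply: xgetPN => y [].
  rewrite S'E => -[x Sx <-] minx; apply: nomin; exists x; split => // y' Sy'.
  by rewrite ler_enorm -!fiso -ler_enorm; apply: minx; exists y'.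
by move=> y hy; apply: nomin; exists y.
Qed.

Lemma min_norm_point_infeasible k d (z : 'cV[R]_k) (B : 'M[R]_(k, d)) :
  ~ (exists y, solutions z B y) -> min_norm_point (solutions z B) = 0.
Proof. by move=> nosol; apply: xgetPN => y [Sy _]; apply: nosol; exists y. Qed.

(** For independent rows this is the least-norm solution Bf^T (Bf Bf^T)^-1 z_f of the equations
    selected by f. With the inverse written as adjugate over determinant, the formula is measurable
    in B even where the determinant vanishes. *)
Definition subsystem_solution k d (z : 'cV[R]_k) (B : 'M[R]_(k, d))
    r (f : 'I_r -> 'I_k) : 'cV[R]_d :=
  let Bf := rowsub f B in let G := Bf *m Bf^T in
  (\det G)^-1 *: (Bf^T *m (\adj G *m rowsub f z)).

(** The candidate lies in the row space of B whatever f is, so solving the whole system already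
    makes it minimal. *)
Lemma subsystem_solution_min k d (z : 'cV[R]_k) (B : 'M[R]_(k, d))
    r (f : 'I_r -> 'I_k) :
  B *m subsystem_solution z B f = z ->
  min_norm_point (solutions z B) = subsystem_solution z B f.
Proof.
have BfT : (rowsub f B)^T = B^T *m (rowsub f 1%:M)^T.
  by rewrite -trmx_mul mul_rowsub_mx mul1mx.
have -> : subsystem_solution z B f = B^T *m ((rowsub f 1%:M)^T *m
    ((\det (rowsub f B *m (rowsub f B)^T))^-1 *:
      (\adj (rowsub f B *m (rowsub f B)^T) *m rowsub f z))).
  by rewrite -!scalemxAr [in RHS]mulmxA -BfT.
exact: min_norm_row_space.
Qed.

Lemma gram_unit r d (B : 'M[R]_(r, d)) : row_free B -> B *m B^T \in unitmx.
Proof.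
move=> freeB; rewrite -row_free_unit -kermx_eq0.
apply/eqP/row_matrixP => i; rewrite row0.
set u := row i _.
have uG : u *m (B *m B^T) = 0 by rewrite -row_mul mulmx_ker row0.
have uB0 : (u *m B)^T = 0.
  apply/eqP; rewrite -dotv_eq0 dotv_mulmx trmxK.
  by rewrite trmx_mul -mulmxA (mulmxA B) mulmxA uG mul0mx mxE.
apply: (row_free_inj freeB); rewrite mul0mx.
by apply: trmx_inj; rewrite uB0 trmx0.
Qed.

(** The rows chosen by [maxrankfun] are a basis of the row space, so their Gram matrix is
    invertible. The other rows are combinations of them, and the existence of y makes z satisfy the
    same relations. *)
Lemma subsystem_solution_exists k d (z : 'cV[R]_k) (B : 'M[R]_(k, d)) y :
  solutions z B y ->
  let f := @maxrankfun R k d B in B *m subsystem_solution z B f = z.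
Proof.
move=> Sy f; pose Bf := rowsub f B.
have uG : Bf *m Bf^T \in unitmx by apply: gram_unit; exact: maxrowsub_free.
have solf : Bf *m subsystem_solution z B f = rowsub f z.
  rewrite /subsystem_solution -/Bf -scalemxAr (mulmxA Bf) mulmxA mul_mx_adj.
  by rewrite mul_scalar_mx scalerA mulVf ?scale1r// -unitfE -unitmxE.
have /submxP [W BW] : (B <= Bf)%MS by rewrite eq_maxrowsub.
by rewrite {1}BW -mulmxA solf -Sy -mul_rowsub_mx mulmxA -BW.
Qed.

End min_norm_solution.

Section min_norm_measurable.
Variable R : realType.

Lemma measurable_invr : measurable_fun setT (fun x : R => x^-1).
Proof.
have -> : (fun x : R => x^-1) = (fun x => x * (x ^+ 2) `^ (-1)).
  apply/funext => x; rewrite powR_inv1 ?sqr_ge0//.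
  have [->|x0] := eqVneq x 0; first by rewrite invr0 mul0r.
  by field.
apply: measurable_funM => //.
by apply: (measurableT_comp (@measurable_powR R (-1))); exact: measurable_funX.
Qed.

Lemma measurable_adj dT (T : measurableType dT) n (F : T -> 'M[R]_n) :
  measurable_fun setT F -> measurable_fun setT (fun t => \adj (F t)).
Proof.
move=> mF; apply: measurable_fun_mx => i j; under eq_fun do rewrite mxE.
rewrite /cofactor; apply: measurable_funM => //; apply: measurable_det.
apply: measurable_fun_mx => i' j'; under eq_fun do rewrite !mxE.
exact: measurable_fun_entry.
Qed.

Lemma measurable_subsystem_solution k d (z : 'cV[R]_k) r (f : 'I_r -> 'I_k) :
  measurable_fun setT (fun B : 'M[R]_(k, d) => subsystem_solution z B f).
Proof.
have mBf : measurable_fun setT (fun B : 'M[R]_(k, d) => rowsub f B).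
  exact: measurable_mxsub.
have mBft : measurable_fun setT (fun B : 'M[R]_(k, d) => (rowsub f B)^T).
  exact: measurable_trmx.
have mG : measurable_fun setT
    (fun B : 'M[R]_(k, d) => rowsub f B *m (rowsub f B)^T).
  exact: measurable_mulmx.
apply: measurable_scalemx.
  by apply: (measurableT_comp measurable_invr); exact: measurable_det.
by do 2 apply: measurable_mulmx => //; exact: measurable_adj.
Qed.

(* The measurable functions of the system [B] given by Cramer's rule on the
   finitely many subsystems of [B *m y = z] cover all feasible [B]. *)
Lemma measurable_min_norm_point k d (z : 'cV[R]_k) :
  measurable_fun setT
    (fun B : 'M[R]_(k, d) => min_norm_point (solutions z B)).
Proof.
(* Selections of at most k rows, encoded by finite functions so that the index type is finite. *)
pose I : finType := {r : 'I_k.+1 & {ffun 'I_r -> 'I_k}}.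
pose g (i : I) (B : 'M[R]_(k, d)) := subsystem_solution z B (tagged i).
pose E (i : I) : set 'M[R]_(k, d) := [set B | B *m g i B = z].
have mg i : measurable_fun setT (g i) by exact: measurable_subsystem_solution.
have mE i : measurable (E i).
  rewrite -[E i]/((fun B : 'M[R]_(k, d) => B *m g i B) @^-1` [set z]).
  apply: measurable_preimageT; last exact: measurable_mx_set1.
  exact: measurable_mulmx.
have cover B y : solutions z B y -> exists i, E i B.
  move=> /subsystem_solution_exists Bf.
  have rk : (\rank B < k.+1)%N by rewrite ltnS rank_leq_row.
  exists (Tagged (fun r : 'I_k.+1 => {ffun 'I_r -> 'I_k})
    ([ffun x => maxrankfun B x] : {ffun 'I_(Ordinal rk) -> 'I_k})).
  rewrite /E/= -[RHS]Bf /g/=; congr (_ *m subsystem_solution _ _ _).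
  by apply/funext => x; rewrite ffunE.
move=> _ C mC; rewrite setTI.
(* Where no candidate solves the system the value is the default 0, so that part is kept or dropped
   as a whole according to [C 0]. *)
have -> : (fun B : 'M[R]_(k, d) => min_norm_point (solutions z B)) @^-1` C =
    \bigcup_(i in [set: I]) (E i `&` g i @^-1` C) `|`
    (\bigcap_(i in [set: I]) ~` E i) `&` (cst 0 @^-1` C).
  apply/seteqP; split => B /=; last first.
    move=> [[i _ [/= Ei gi]]|[noE C0]].
      by rewrite (subsystem_solution_min Ei).
    rewrite min_norm_point_infeasible// => -[y /cover[i Ei]].
    exact: (noE i Logic.I).
  have [[i Ei]|noE] := pselect (exists i, E i B).
    by rewrite (subsystem_solution_min Ei) => Cg; left; exists i.
  rewrite min_norm_point_infeasible; last by move=> [y /cover].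
  by move=> C0; right; split => // i _ Ei; apply: noE; exists i.
apply: measurableU.
  apply: fin_bigcup_measurable => // i _; apply: measurableI => //.
  exact: measurable_preimageT.
apply: measurableI; last exact: measurable_preimageT.
by apply: fin_bigcap_measurable => // i _; exact: measurableC.
Qed.

(** The vector w in rotated coordinates: the top rows of M are the system, the bottom rows are
    applied to its least-norm solution. *)
Definition min_norm_image k m d (z : 'cV[R]_k) (M : 'M[R]_(k + m, d)) : 'cV[R]_m :=
  dsubmx M *m min_norm_point (solutions z (usubmx M)).

Lemma measurable_min_norm_image k m d (z : 'cV[R]_k) :
  measurable_fun setT (@min_norm_image k m d z).
Proof.
apply: measurable_mulmx; first by apply: measurable_dsubmx.
apply: (measurableT_comp (measurable_min_norm_point z)).
exact: measurable_usubmx.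
Qed.

End min_norm_measurable.

Section orthogonal.
Variable R : realType.

(** O is the Householder reflection along h = v - a, where a is the target; when v = a the identity
    serves. *)
Lemma row_rotation n (v : 'rV[R]_n.+1) : exists2 O : 'M[R]_n.+1,
  O *m O^T = 1%:M &
  v *m O = row_mx (enorm v^T)%:M (0 : 'rV[R]_n).
Proof.
pose a : 'rV[R]_n.+1 := row_mx (enorm v^T)%:M (0 : 'rV[R]_n).
rewrite -[row_mx _ _]/a.
have aa : a *m a^T = v *m v^T.
  rewrite /a (@tr_row_mx _ 1 1 n) [LHS](@mul_row_col _ 1 1 n 1).
  rewrite trmx0 mulmx0 addr0 tr_scalar_mx -scalar_mxM -expr2 enorm_sqr.
  by rewrite dotv_mulmx trmxK -mx11_scalar.
have [va|va] := eqVneq v a.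
  by exists 1%:M; [rewrite mul1mx trmx1|rewrite mulmx1].
have [h hE] : {h | h = v - a} by exists (v - a).
pose q := dotv h^T h^T.
have q0 : q != 0 by rewrite dotv_eq0 hE -(trmx0 _ _ _) (inj_eq trmx_inj) subr_eq0.
have hhT : h *m h^T = q%:M by rewrite /q dotv_mulmx trmxK -mx11_scalar.
(* Since v and a have equal norm, |h|^2 = 2 v h^T; this makes the reflection send v to v - h = a. *)
have vh : v *m h^T = (q / 2)%:M.
  have av : a *m v^T = v *m a^T.
    by rewrite [LHS]mx11_scalar [RHS]mx11_scalar -[a *m v^T]trmxK trmx_mul trmxK mxE.
  have : h *m h^T = 2 *: (v *m h^T).
    rewrite hE linearB/= !(mulmxBl, mulmxBr) aa av.
    by rewrite opprB -addrA addrC; apply/matrixP => i j; rewrite !mxE; ring.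
  rewrite hhT => /(congr1 (fun M => 2^-1 *: M)).
  by rewrite scalerA mulVf ?pnatr_eq0// scale1r scale_scalar_mx mulrC => <-.
pose O : 'M[R]_n.+1 := 1%:M - (2 / q) *: (h^T *m h).
have OT : O^T = O by rewrite /O linearB linearZ/= trmx1 trmx_mul trmxK.
exists O.
  have PP : (h^T *m h) *m (h^T *m h) = q *: (h^T *m h).
    by rewrite mulmxA -(mulmxA h^T) hhT mul_mx_scalar -scalemxAl.
  rewrite OT /O mulmxBl mul1mx mulmxBr mulmx1 -scalemxAl -scalemxAr PP.
  rewrite !scalerA (_ : 2 / q * (2 / q) * q = 2 / q + 2 / q); last by field.
  by apply/matrixP => i j; rewrite !mxE; ring.
rewrite /O mulmxBr mulmx1 -scalemxAr mulmxA vh mul_scalar_mx scalerA.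
rewrite (_ : 2 / q * (q / 2) = 1) ?scale1r ?hE ?subKr//.
by field.
Qed.

End orthogonal.

(** * Law of the image of the least-norm solution *)

Section min_norm_image_law.
Variable R : realType.

Lemma measurable_enorm dT (T : measurableType dT) n (F : T -> 'cV[R]_n) :
  measurable_fun setT F -> measurable_fun setT (fun t => enorm (F t)).
Proof.
move=> mF.
have -> : (fun t => enorm (F t)) = (fun t => (dotv (F t) (F t)) `^ 2^-1).
  by apply/funext => t; rewrite powR12_sqrt// dotv_ge0.
apply: (measurableT_comp (@measurable_powR R 2^-1)).
by apply: measurable_sum => i; apply: measurable_funM; exact: measurable_fun_entry.
Qed.

Lemma measurable_gauss_mx_section dT (T : measurableType dT) dT'
    (T' : measurableType dT') m n (G : T * 'M[R]_(m, n) -> T') (S : set T') :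
  measurable_fun setT G -> measurable S ->
  measurable_fun setT (fun t => gauss_mx [set C | S (G (t, C))]).
Proof.
move=> mG mS.
have := measurable_fun_xsection (@gauss_mx R m n) (measurable_preimageT mG mS).
congr (measurable_fun _ _); apply/funext => t /=; congr gauss_mx.
by apply/seteqP; split => C; rewrite /xsection /= inE.
Qed.

Lemma gauss_mx_row0 n : gauss_mx [set (0 : 'rV[R]_n.+1)] = 0%E.
Proof.
rewrite mxbox_set1 gauss_mx_box// (bigD1 (ord0, ord0))//= mxE.
rewrite (_ : normal_prob _ _ _ = 0%E) ?mul0e//.
have /null_content_dominatesP := @normal_prob_dominates R 0 1.
by apply => //; exact: lebesgue_measure_set1.
Qed.

(** A Gaussian row vanishes with probability zero. Discarding this event permits division by
    [enorm b^T] and the elimination of an unknown. *)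
Lemma eq_integral_gauss_row n (f g : 'rV[R]_n.+1 -> \bar R) :
  measurable_fun setT f -> measurable_fun setT g ->
  (forall b, b != 0 -> f b = g b) ->
  (\int[@gauss_mx R 1 n.+1]_b f b = \int[@gauss_mx R 1 n.+1]_b g b)%E.
Proof.
move=> mf mg fg; apply: ae_eq_integral => //.
exists [set 0]; split.
- exact: measurable_mx_set1.
- exact: gauss_mx_row0.
- move=> b /= /not_implyP[_ nfg]; apply: contrapT => /eqP b0.
  by apply: nfg; exact: fg.
Qed.

Lemma gauss_mx_lsubmx n a c (S : set 'M[R]_(n, a)) : measurable S ->
  gauss_mx [set M : 'M[R]_(n, a + c) | S (lsubmx M)] = gauss_mx S.
Proof.
have -> : [set M : 'M[R]_(n, a + c) | S (lsubmx M)] =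
    [set M | [set N | [set C : 'M[R]_(a, n) | S C^T] (usubmx N)] M^T].
  by apply/seteqP; split => M /=; rewrite trmx_usub trmxK.
move=> mS.
have mS' : measurable [set C : 'M[R]_(a, n) | S C^T].
  exact: (measurable_preimageT (measurable_trmx (@measurable_id _ _ setT))).
rewrite gauss_mx_trmx; last first.
  exact: (measurable_preimageT (measurable_usubmx (@measurable_id _ _ setT))).
by rewrite gauss_mx_usubmx// gauss_mx_trmx.
Qed.

(** The least-norm solution y becomes [O^T *m y], and the rotation cancels when the bottom rows are
    applied. *)
Lemma min_norm_image_mulr k m d (z : 'cV[R]_k) (M : 'M[R]_(k + m, d))
    (O : 'M[R]_d) : O *m O^T = 1%:M ->
  min_norm_image z (M *m O) = min_norm_image z M.
Proof.
move=> OO; have OTO : O^T *m O = 1%:M by exact: mulmx1C.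
rewrite /min_norm_image -mul_usub_mx -mul_dsub_mx.
rewrite (@min_norm_point_isometry _ _ _ _ _ z (usubmx M) z _ (mulmx O^T)).
- by rewrite !mulmxA -(mulmxA _ O) OO mulmx1.
- exact: mulmx0.
- by move=> y; rewrite dotv_mull trmxK mulmxA OO mul1mx.
- apply/seteqP; split => y; rewrite /solutions /=.
    move=> Sy; exists (O *m y); first by rewrite mulmxA.
    by rewrite mulmxA OTO mul1mx.
  by move=> [x Sx <-]; rewrite -mulmxA (mulmxA O) OO mul1mx.
Qed.

Lemma usubmx_col_mx1 k m d (b : 'rV[R]_d) (N : 'M[R]_(k + m, d)) :
  usubmx (col_mx b N : 'M[R]_(k.+1 + m, d)) = col_mx b (usubmx N) :> 'M[R]_(1 + k, d).
Proof.
apply/matrixP => i j; rewrite mxE.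
case: (split_ordP (i : 'I_(1 + k))) => i' ->.
  rewrite [RHS]col_mxEu (_ : lshift m _ = lshift (k + m) i' :> 'I_(k.+1 + m)); last exact/val_inj.
  by rewrite [LHS]col_mxEu.
rewrite [RHS]col_mxEd (_ : lshift m _ = rshift 1 (lshift m i') :> 'I_(k.+1 + m)); last exact/val_inj.
by rewrite [LHS]col_mxEd mxE.
Qed.

Lemma dsubmx_col_mx1 k m d (b : 'rV[R]_d) (N : 'M[R]_(k + m, d)) :
  dsubmx (col_mx b N : 'M[R]_(k.+1 + m, d)) = dsubmx N.
Proof.
apply/matrixP => i j; rewrite mxE [RHS]mxE.
rewrite (_ : rshift k.+1 i = rshift 1 (rshift k i) :> 'I_(k.+1 + m)); last exact/val_inj.
by rewrite [LHS]col_mxEd.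
Qed.

(** The first equation forces the first unknown to be 0, so the solutions are those of the smaller
    system padded with a zero, and padding preserves the norm. *)
Lemma min_norm_image_peel k m d (z : 'cV[R]_k) (c : R)
    (N : 'M[R]_(k + m, 1 + d)) : c != 0 ->
  min_norm_image (col_mx 0 z : 'cV[R]_(1 + k))
    (col_mx (row_mx c%:M 0 : 'rV[R]_(1 + d)) N : 'M[R]_(k.+1 + m, 1 + d)) =
  min_norm_image z (rsubmx N).
Proof.
move=> c0; rewrite /min_norm_image usubmx_col_mx1 dsubmx_col_mx1.
rewrite (@min_norm_point_isometry _ _ _ _ _ z (usubmx (rsubmx N)) _ _
  (fun y => col_mx 0 y : 'cV[R]_(1 + d))).
- rewrite -[dsubmx N]hsubmxK mul_row_col mulmx0 add0r.
  by congr (_ *m _); apply/matrixP => i j; rewrite !mxE.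
- exact: col_mx0.
- by move=> y; rewrite !dotv_mulmx tr_col_mx mul_row_col trmx0 mul0mx add0r.
- apply/seteqP; split => y; rewrite /solutions /=.
    rewrite -[y]vsubmxK [in LHS](@mul_col_mx _ 1 k) mul_row_col mul0mx addr0.
    move=> /(@eq_col_mx _ 1 k) [cy Ny].
    have y0 : usubmx y = 0.
      apply: (scalerI c0); rewrite scaler0 -mul_scalar_mx; exact: cy.
    exists (dsubmx y); last by rewrite y0.
    rewrite -Ny y0 -[usubmx N]hsubmxK mul_row_col mulmx0 add0r.
    by congr (_ *m _); apply/matrixP => i j; rewrite !mxE.
  move=> [x Sx <-]; rewrite [LHS](@mul_col_mx _ 1 k) mul_row_col mulmx0 mul0mx.
  rewrite addr0 -Sx -[usubmx N]hsubmxK mul_row_col mulmx0 add0r.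
  by congr (@col_mx _ 1 k _ _ (_ *m _)); apply/matrixP => i j; rewrite !mxE.
Qed.

(** The nonzero entry sits last, so that rows removed from the top have right-hand side 0 and the
    final single row retains a. *)
Definition last_cv k (a : R) : 'cV[R]_k.+1 :=
  \col_i (if i == ord_max then a else 0).

Lemma last_cvS k a : last_cv k.+1 a = (col_mx 0 (last_cv k a) : 'cV[R]_(1 + k.+1)).
Proof.
apply/matrixP => i j; rewrite [LHS]mxE.
case: (split_ordP (i : 'I_(1 + k.+1))) => i' ->.
  by rewrite [RHS]col_mxEu mxE -val_eqE /= ord1.
by rewrite [RHS]col_mxEd mxE -!val_eqE /= add1n eqSS.
Qed.

Lemma min_norm_image_row m d (a : R) (b : 'rV[R]_d) (C : 'M[R]_(m, d)) :
  b != 0 ->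
  min_norm_image (last_cv 0 a) (col_mx b C) =
  (a / enorm b^T ^+ 2) *: (C *m b^T).
Proof.
move=> b0; rewrite /min_norm_image col_mxKu col_mxKd.
have bb : b *m b^T = (enorm b^T ^+ 2)%:M.
  by rewrite enorm_sqr dotv_mulmx trmxK -mx11_scalar.
rewrite (@min_norm_row_space _ _ _ _ _ (a / enorm b^T ^+ 2)%:M).
  by rewrite mul_mx_scalar scalemxAr.
rewrite mulmxA bb -scalar_mxM mulrC divfK; last first.
  by rewrite sqrf_eq0 enorm_eq0 -(trmx0 _ _ _) (inj_eq trmx_inj).
by apply/matrixP => i j; rewrite !ord1 !mxE.
Qed.

(** Law of a eta / |b| for independent standard Gaussian vectors eta in R^m and b in R^n: the
    t-distribution as a Gaussian divided by a chi variable. *)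
Definition scale_mixture m n (a : R) (S : set 'cV[R]_m) : \bar R :=
  (\int[@gauss_mx R 1 n]_b
    gauss_mx [set eta : 'cV[R]_m | S ((a / enorm b^T) *: eta)])%E.

Lemma measurable_scale_mixture_integrand m n (a : R) (S : set 'cV[R]_m) :
  measurable S ->
  measurable_fun [set: 'rV[R]_n]
    (fun b => gauss_mx [set eta : 'cV[R]_m | S ((a / enorm b^T) *: eta)]).
Proof.
move=> mS; apply: (@measurable_gauss_mx_section _ 'rV[R]_n _ 'cV[R]_m m 1 (fun be =>
  (a / enorm be.1^T) *: be.2)) => //.
apply: measurable_scalemx => //; apply: measurable_funM => //.
apply: (measurableT_comp (@measurable_invr R)); apply: measurable_enorm.
exact: measurable_trmx.
Qed.

Lemma measurable_min_norm_image_section k m n (z : 'cV[R]_k.+1) (S : set 'cV[R]_m) :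
  measurable S ->
  measurable_fun [set: 'rV[R]_n] (fun b => gauss_mx
    [set C : 'M[R]_(k + m, n) |
      S (min_norm_image z (col_mx b C : 'M[R]_(k.+1 + m, n)))]).
Proof.
move=> mS; apply: (@measurable_gauss_mx_section _ 'rV[R]_n _ 'cV[R]_m (k + m) n (fun bC =>
  min_norm_image z (col_mx bC.1 bC.2 : 'M[R]_(k.+1 + m, n)))) => //.
apply: (measurableT_comp (measurable_min_norm_image (k := k.+1) z)).
exact: (@measurable_col_mx _ _ _ 1).
Qed.

(* Conditioning on the first row [b] of the system and rotating it onto the
   first axis either removes one equation and one unknown, or, when [b] is the
   only row, makes [b] independent of the image up to its length. *)
Lemma gauss_mx_min_norm_image k m n (a : R) (S : set 'cV[R]_m) :
  measurable S ->
  gauss_mx [set M : 'M[R]_(k.+1 + m, k + n.+1) |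
    S (min_norm_image (last_cv k a) M)] = scale_mixture n.+1 a S.
Proof.
move=> mS; elim: k => [|k IH].
  rewrite (@gauss_mx_col_mx _ 1 m); last first.
    exact: (measurable_preimageT (measurable_min_norm_image _)).
  apply: eq_integral_gauss_row.
  - exact: (@measurable_min_norm_image_section 0).
  - exact: measurable_scale_mixture_integrand.
  move=> b b0; have [Q QQ bQ] := row_rotation b.
  have QTQ : Q^T *m (Q^T)^T = 1%:M by rewrite trmxK; exact: mulmx1C.
  have mC : measurable [set C : 'M[R]_(m, n.+1) |
      S ((a / enorm b^T ^+ 2) *: (C *m b^T))].
    apply: (measurable_preimageT (f := fun C : 'M[R]_(m, n.+1) =>
      (a / enorm b^T ^+ 2) *: (C *m b^T))) => //.
    by apply: measurable_scalemx => //; exact: measurable_mulmxr.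
  transitivity (gauss_mx [set C : 'M[R]_(m, n.+1) |
      S ((a / enorm b^T ^+ 2) *: (C *m b^T))]).
    by congr gauss_mx; apply/seteqP; split => C /=; rewrite min_norm_image_row.
  rewrite -(gauss_mx_mulr QTQ)//.
  have mE : measurable [set eta : 'cV[R]_m | S ((a / enorm b^T) *: eta)].
    apply: (measurable_preimageT (f := fun eta : 'cV[R]_m =>
      (a / enorm b^T) *: eta)) => //.
    exact: measurable_scalemx.
  rewrite -(@gauss_mx_lsubmx _ 1 n _ mE).
  congr gauss_mx; apply/seteqP.
  have bn0 : enorm b^T != 0.
    by rewrite enorm_eq0 -(trmx0 _ _ _) (inj_eq trmx_inj).
  (* Since b Q = (|b|, 0), the product C Q^T b^T is |b| times the first column of C, which cancels
     one factor |b|. *)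
  have E C : (a / enorm b^T ^+ 2) *: (C *m Q^T *m b^T) =
      (a / enorm b^T) *: lsubmx (C : 'M[R]_(m, 1 + n)).
    rewrite -mulmxA -trmx_mul bQ -[in LHS](hsubmxK (C : 'M[R]_(m, 1 + n))).
    rewrite (@tr_row_mx _ 1 1 n) trmx0 (@mul_row_col _ m 1 n 1) mulmx0 addr0.
    rewrite tr_scalar_mx mul_mx_scalar.
    by rewrite scalerA; congr (_ *: _); field.
  by split => C /=; rewrite E.
rewrite (@gauss_mx_col_mx _ 1 (k.+1 + m)); last first.
  exact: (measurable_preimageT (measurable_min_norm_image (k := k.+2) _)).
(* For every nonzero b the conditional probability is already that of the smaller problem, so the
   outer integrand is constant. *)
transitivity (\int[@gauss_mx R 1 (k.+1 + n.+1)]_b scale_mixture n.+1 a S)%E.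
  apply: (@eq_integral_gauss_row (k + n.+1)).
  - exact: (@measurable_min_norm_image_section k.+1).
  - exact: measurable_cst.
  move=> b b0; rewrite -IH; have [Q QQ bQ] := row_rotation b.
  have QTQ : Q^T *m (Q^T)^T = 1%:M by rewrite trmxK; exact: mulmx1C.
  rewrite -(gauss_mx_mulr QTQ); last first.
    apply: (measurable_preimageT (f := fun C : 'M[R]_(k.+1 + m, (k + n.+1).+1) =>
      min_norm_image (last_cv k.+1 a) (col_mx b C : 'M[R]_(k.+2 + m, _)))) => //.
    apply: (measurableT_comp (measurable_min_norm_image (k := k.+2) _)).
    exact: (@measurable_col_mx _ _ _ 1).
  rewrite -[RHS](@gauss_mx_rsubmx _ _ 1); last first.
    exact: (measurable_preimageT (measurable_min_norm_image (k := k.+1) _)).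
  congr gauss_mx; apply/seteqP.
  have bn0 : enorm b^T != 0.
    by rewrite enorm_eq0 -(trmx0 _ _ _) (inj_eq trmx_inj).
  (* Multiplying the stacked matrix by Q turns b into (|b|, 0) and undoes the factor Q^T that
     invariance allowed next to C. *)
  have E C : min_norm_image (last_cv k.+1 a)
      (col_mx b (C *m Q^T) : 'M[R]_(k.+2 + m, _)) =
      min_norm_image (last_cv k a) (rsubmx (C : 'M[R]_(k.+1 + m, 1 + (k + n.+1)))).
    rewrite -(min_norm_image_mulr _ _ QQ).
    rewrite [col_mx b _ *m Q](@mul_col_mx _ 1 (k.+1 + m)) bQ -mulmxA.
    rewrite (_ : Q^T *m Q = 1%:M) ?mulmx1; last exact: mulmx1C.
    by rewrite last_cvS min_norm_image_peel.
  by split => C /=; rewrite E.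
rewrite integral_cst//.
by rewrite [X in (_ * X)%E](@probability_setT _ _ _ (@gauss_mx R 1 _)) mule1.
Qed.

End min_norm_image_law.

(** * Radial integrals *)

Section radial_integrals.
Variable R : realType.
Local Notation leb := (@lebesgue_measure R).
Local Notation lebn := (lebesgue_cv R).
Local Open Scope ereal_scope.

Lemma lebesgue_cv_singleton0 n : lebn n.+1 [set 0%R] = 0.
Proof.
have m0 : measurable [set (0 : 'cV[R]_n.+1)%R] by exact: measurable_mx_set1.
rewrite -[X in lebn _ X]setIT -integral_indic//.
transitivity (\int[lebn n.+1]_v
    (\prod_(i < n.+1) (\1_[set 0] (v i ord0) : R))%R%:E).
  apply: eq_integral => v _; congr (_%:E).
  have [->|v0] := eqVneq v 0%R.
    by rewrite indicE mem_set// big1// => i _; rewrite mxE indicE mem_set.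
  have [i vi0] : exists i, v i ord0 != 0%R.
    apply/existsP; apply: contraR v0 => /existsPn v0.
    by apply/eqP/colP => i; rewrite [RHS]mxE; have /negPn/eqP := v0 i.
  rewrite indicE memNset; last exact/eqP.
  by rewrite (bigD1 i)//= indicE memNset ?mul0r//; exact/eqP.
rewrite (@ge0_integral_lebesgue_cv_prod _ _ (fun=> \1_[set 0%R])).
- rewrite big_ord_recl integral_indic// setIT.
  by rewrite [X in X * _](@lebesgue_measure_set1 R) mul0e.
- by move=> i; exact: measurable_indic.
- by [].
Qed.

Lemma enormZ n (c : R) (v : 'cV[R]_n) : enorm (c *: v) = (`|c| * enorm v)%R.
Proof.
by rewrite /enorm dotvZl dotvZr mulrA -expr2 sqrtrM ?sqr_ge0// sqrtr_sqr.
Qed.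

Variable n : nat.
Let N := n.+1.
Let nu (v : 'cV[R]_N) : R := (enorm v ^- N)%R.
Let beta (v : 'cV[R]_N) : R := (enorm v ^+ 2 / 2)%R.

Definition mellin_half_line (h : R -> R) := \int[leb]_t (h t / t)%:E.

Definition mellin_radial (h : R -> R) :=
  \int[lebn N]_v (h (beta v) * nu v)%:E.

Let nu_ge0 v : (0 <= nu v)%R.
Proof. by rewrite /nu invr_ge0 exprn_ge0// enorm_ge0. Qed.

Let measurable_nu : measurable_fun setT nu.
Proof.
apply: (measurableT_comp (@measurable_invr R)); apply: measurable_funX.
exact: measurable_enorm.
Qed.

Let measurable_beta : measurable_fun setT beta.
Proof.
by apply: measurable_funM => //; apply: measurable_funX; exact: measurable_enorm.
Qed.

(** The dilation of v by sqrt t multiplies [beta] by t, and its Jacobian cancels against the change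
    of [nu]. *)
Let mellin_radial_scale (h : R -> R) (t : R) :
  measurable_fun setT h -> (forall x, (0 <= h x)%R) -> (0 < t)%R ->
  \int[lebn N]_v (h (t * beta v) * nu v)%:E = mellin_radial h.
Proof.
move=> mh h0 t0.
have st0 : (0 < Num.sqrt t)%R by rewrite sqrtr_gt0.
pose f v := (h (beta v) * nu v)%:E.
have mf : measurable_fun setT f.
  by apply/measurable_EFinP; apply: measurable_funM => //; exact: measurableT_comp.
have f0 v : 0 <= f v by rewrite lee_fin mulr_ge0.
have := ge0_integral_lebesgue_cv_scale st0 mf f0.
rewrite -/(mellin_radial h) => fs.
rewrite -[RHS]mul1e -(@divff _ (Num.sqrt t ^+ N)%R); last first.
  by rewrite gt_eqF// exprn_gt0.
rewrite EFinM -muleA -fs -ge0_integralZl//; last first.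
  by apply: (measurableT_comp mf); exact: measurable_scalemx.
apply: eq_integral => v _; rewrite -EFinM; congr (_%:E).
rewrite /nu /beta enormZ (ger0_norm (sqrtr_ge0 _)) !exprMn (sqr_sqrtr (ltW t0)).
rewrite [in RHS]invfM [in RHS]mulrCA [X in _ = (_ * X)%R]mulrA.
by rewrite divff ?mul1r ?mulrA// gt_eqF// exprn_gt0.
Qed.

(** The inner integral does not depend on the positive factor [s t], so the double integral is a
    product. The exchange takes s to be the identity on one side and the inversion on the other. *)
Let mellin_factor (h h' s : R -> R) :
  measurable_fun setT h -> (forall x, (0 <= h x)%R) ->
  (forall x, (x <= 0)%R -> h x = 0%R) ->
  measurable_fun setT h' -> (forall x, (0 <= h' x)%R) ->
  (forall t, (0 < t)%R -> (0 < s t)%R) ->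
  \int[leb]_t \int[lebn N]_v (h t / t * (h' (s t * beta v) * nu v))%:E =
  mellin_half_line h * mellin_radial h'.
Proof.
move=> mh h0 hneg mh' h'0 s0.
have ht0 t : (0 <= h t / t)%R.
  have [t0|t0] := ltP 0%R t; first by rewrite divr_ge0// ltW.
  by rewrite hneg// mul0r.
have mht : measurable_fun setT (fun t => h t / t)%R.
  by apply: measurable_funM => //; exact: measurable_invr.
rewrite /mellin_half_line -ge0_integralZr//; last 3 first.
- exact/measurable_EFinP.
- by move=> t _; rewrite lee_fin.
- by apply: integral_ge0 => v _; rewrite lee_fin mulr_ge0.
apply: eq_integral => t _; have [t0|t0] := ltP 0%R t; last first.
  rewrite hneg// !mul0r mul0e.
  by apply: integral0_eq => v _; rewrite mul0r.
rewrite -(mellin_radial_scale mh' h'0 (s0 _ t0)) -ge0_integralZl_EFin//.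
- by move=> v _; rewrite lee_fin mulr_ge0.
- apply/measurable_EFinP; apply: measurable_funM => //.
  by apply: (measurableT_comp mh'); exact: measurable_funM.
Qed.

(* Both sides equal the same double integral: [dt / t] is invariant under
   dilations, [|v| ^ - N dv] is, and [h1] is invariant under inversion, so no
   polar coordinates are needed. *)
Lemma mellin_exchange (h1 h2 : R -> R) :
  measurable_fun setT h1 -> (forall x, (0 <= h1 x)%R) ->
  (forall x, (x <= 0)%R -> h1 x = 0%R) -> (forall x, h1 x^-1 = h1 x)%R ->
  measurable_fun setT h2 -> (forall x, (0 <= h2 x)%R) ->
  (forall x, (x <= 0)%R -> h2 x = 0%R) ->
  mellin_half_line h1 * mellin_radial h2 = mellin_half_line h2 * mellin_radial h1.
Proof.
move=> mh1 h10 h1neg h1inv mh2 h20 h2neg.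
rewrite -(mellin_factor (s := id) mh1 h10 h1neg mh2 h20)//.
rewrite -(mellin_factor (s := fun t => t^-1%R) mh2 h20 h2neg mh1 h10); last first.
  by move=> t; rewrite invr_gt0.
have quot_ge0 (h : R -> R) : (forall x, (0 <= h x)%R) ->
    (forall x, (x <= 0)%R -> h x = 0%R) -> forall t, (0 <= h t / t)%R.
  move=> h0 hneg t; have [t0|t0] := ltP 0%R t; first by rewrite divr_ge0// ltW.
  by rewrite hneg// mul0r.
have mfst : measurable_fun setT (fst : R * 'cV[R]_N -> R).
  exact: measurable_fst.
have msnd : measurable_fun setT (snd : R * 'cV[R]_N -> 'cV[R]_N).
  exact: measurable_snd.
have mnu : measurable_fun setT (nu \o snd : R * 'cV[R]_N -> R).
  exact: measurableT_comp.
have mbeta : measurable_fun setT (beta \o snd : R * 'cV[R]_N -> R).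
  exact: measurableT_comp.
have minv : measurable_fun setT (fun tv : R * 'cV[R]_N => tv.1^-1%R).
  by apply: (measurableT_comp (@measurable_invr R)).
rewrite (fubini_tonelli (m1 := leb) (m2 := lebn N) (fun tv =>
  (h1 tv.1 / tv.1 * (h2 (tv.1 * beta tv.2) * nu tv.2))%:E)); last 2 first.
- apply/measurable_EFinP; apply: measurable_funM; apply: measurable_funM => //.
    by apply: (measurableT_comp mh1).
  by apply: (measurableT_comp mh2); exact: measurable_funM.
- by move=> -[t v]; rewrite lee_fin mulr_ge0//= ?quot_ge0// mulr_ge0.
rewrite (fubini_tonelli (m1 := leb) (m2 := lebn N) (fun tv =>
  (h2 tv.1 / tv.1 * (h1 (tv.1^-1 * beta tv.2) * nu tv.2))%:E)); last 2 first.
- apply/measurable_EFinP; apply: measurable_funM; apply: measurable_funM => //.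
    by apply: (measurableT_comp mh2).
  by apply: (measurableT_comp mh1); exact: measurable_funM.
- by move=> -[t v]; rewrite lee_fin mulr_ge0//= ?quot_ge0// mulr_ge0.
apply: eq_integral => v _ /=.
(* At the origin [nu] is 0, by the convention on the inverse of 0, and both sides vanish. *)
have [->|v0] := eqVneq v 0%R.
  have -> : nu 0%R = 0%R.
    by rewrite /nu (_ : enorm 0 = 0%R) ?expr0n ?invr0//; apply/eqP; rewrite enorm_eq0.
  by apply: eq_integral => t _; rewrite !mulr0.
have b0 : (0 < beta v)%R.
  by rewrite divr_gt0// exprn_gt0// lt_neqAle enorm_ge0 andbT eq_sym enorm_eq0.
have bn0 : beta v != 0%R by rewrite gt_eqF.
pose F (s : R) := (h1 (s / beta v) / (s / beta v) * (h2 s * nu v))%:E.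
have msb : measurable_fun setT (fun s : R => s / beta v)%R.
  exact: measurable_funM.
have mF : measurable_fun setT F.
  apply/measurable_EFinP; apply: measurable_funM; apply: measurable_funM => //.
    exact: measurableT_comp.
  exact: (measurableT_comp (@measurable_invr R)).
have F0 s : 0 <= F s by rewrite lee_fin mulr_ge0 ?quot_ge0// mulr_ge0.
(* Substitution s = t * [beta v] for fixed v; the invariance of h1 under inversion then turns h1 (s
   / beta v) into h1 (beta v / s). *)
transitivity (\int[leb]_t F (beta v * t + 0)%R).
  apply: eq_integral => t _; rewrite /F addr0 [(beta v * t)%R]mulrC.
  by rewrite mulfK.
rewrite ge0_integral_affine// -ge0_integralZl//.
have E (b c s : R) : b != 0%R ->
    (b^-1 * (h1 (s / b) / (s / b) * (h2 s * c)) =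
    h2 s / s * (h1 (s^-1 * b) * c))%R.
  move=> bneq0; rewrite -(h1inv (s / b)%R) invf_div [(b / s)%R]mulrC.
  have [->|s0] := eqVneq s 0%R; first by rewrite invr0 !(mul0r, mulr0).
  by field; rewrite s0 bneq0.
by apply: eq_integral => s _; rewrite /F -EFinM gtr0_norm// E.
Qed.

End radial_integrals.

(** * Moments of the norm of a Gaussian vector *)

Section chi_moments.
Variable R : realType.
Local Notation leb := (@lebesgue_measure R).
Local Notation lebn := (lebesgue_cv R).
Local Open Scope ereal_scope.

(** Lets convergence of the Gamma integrals be read off from a product identity, without
    estimates. *)
Lemma mule_eq_pos_fin (x y : \bar R) (r : R) :
  0 <= x -> 0 <= y -> (0 < r)%R -> x * y = r%:E ->
  exists a b : R, [/\ x = a%:E, y = b%:E, (0 < a)%R & (0 < b)%R].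
Proof.
move=> + + r0; case: x y => [a| |] [b| |] //=.
- rewrite !lee_fin => a0 b0; rewrite -EFinM => -[abr].
  exists a, b; split => //.
    by rewrite lt_neqAle a0 andbT eq_sym; apply: contraTneq r0 => a00; rewrite -abr a00 mul0r ltxx.
  by rewrite lt_neqAle b0 andbT eq_sym; apply: contraTneq r0 => b00; rewrite -abr b00 mulr0 ltxx.
- rewrite lee_fin le_eqVlt => /orP[/eqP<-|a0] _; last by rewrite gt0_muley// lte_fin.
  by rewrite mul0e => -[r00]; rewrite -r00 ltxx in r0.
- move=> _; rewrite lee_fin le_eqVlt => /orP[/eqP<-|b0]; last by rewrite gt0_mulye// lte_fin.
  by rewrite mule0 => -[r00]; rewrite -r00 ltxx in r0.
Qed.

(** The test function for [mellin_exchange]: invariant under inversion and supported away from 0 and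
    infinity. Its half-line integral cancels in the end, so finiteness and positivity are all that
    is recorded of it. *)
Let h1 : R -> R := \1_(`[(2^-1)%R, 2%R]%classic).

Let measurable_h1 : measurable_fun setT h1.
Proof. exact: measurable_indic. Qed.

Let h1_ge0 x : (0 <= h1 x)%R.
Proof. by rewrite /h1. Qed.

Let h1_neg x : (x <= 0)%R -> h1 x = 0%R.
Proof.
move=> x0; rewrite /h1 indicE memNset//= in_itv/= => /andP[x1 _].
by move: x1; rewrite leNgt (le_lt_trans x0)// invr_gt0.
Qed.

Let h1_inv x : h1 x^-1%R = h1 x.
Proof.
have [x0|x0] := ltP 0%R x; last by rewrite !h1_neg// invr_le0.
have e1 : (2^-1 <= x^-1)%R = (x <= 2)%R by rewrite lef_pV2 ?posrE.
have e2 : (x^-1 <= 2)%R = (2^-1 <= x)%R.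
  by rewrite -[X in (_ <= X)%R]invrK lef_pV2 ?posrE ?invr_gt0.
rewrite /h1 !indicE; congr (_%:R); congr nat_of_bool.
by apply/idP/idP; rewrite !inE/= !in_itv/= e1 e2 andbC.
Qed.

Let mellin_h1 : exists2 A : R, (0 < A)%R & mellin_half_line h1 = A%:E.
Proof.
have mq : measurable_fun setT (fun t : R => (h1 t / t)%:E).
  apply/measurable_EFinP; apply: measurable_funM => //; exact: measurable_invr.
have q0 t : 0 <= (h1 t / t)%:E.
  rewrite lee_fin; have [t0|t0] := ltP 0%R t; first by rewrite divr_ge0// ltW.
  by rewrite h1_neg// mul0r.
have itvE : \int[leb]_t (h1 t)%:E = (2 - 2^-1)%:E.
  rewrite integral_indic// setIT [LHS]lebesgue_measure_itv/= lte_fin ifT//.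
  by lra.
have ub : mellin_half_line h1 <= (2 * (2 - 2^-1))%:E.
  rewrite EFinM -itvE -ge0_integralZl_EFin//; last 2 first.
  - by move=> t _; rewrite lee_fin.
  - exact/measurable_EFinP.
  apply: ge0_le_integral => //.
  - by apply: emeasurable_funM => //; exact/measurable_EFinP.
  move=> t _; rewrite -EFinM lee_fin /h1 indicE.
  have [|_] := boolP (t \in _); last by rewrite mul0r mulr0.
  rewrite inE/= in_itv/= => /andP[t1 _]; rewrite mul1r mulr1.
  have t0 : (0 < t)%R by apply: lt_le_trans t1; lra.
  by rewrite -[X in (_ <= X)%R]invrK lef_pV2 ?posrE ?invr_gt0.
have lb : (2^-1 * (2 - 2^-1))%:E <= mellin_half_line h1.
  rewrite EFinM -itvE -ge0_integralZl_EFin//; last 2 first.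
  - by move=> t _; rewrite lee_fin.
  - exact/measurable_EFinP.
  apply: ge0_le_integral => //.
  - by move=> t _; rewrite mule_ge0// lee_fin.
  - by apply: emeasurable_funM => //; exact/measurable_EFinP.
  move=> t _; rewrite -EFinM lee_fin /h1 indicE.
  have [|_] := boolP (t \in _); last by rewrite mul0r mulr0.
  rewrite inE/= in_itv/= => /andP[t1 t2]; rewrite mul1r mulr1.
  have t0 : (0 < t)%R by apply: lt_le_trans t1; lra.
  by rewrite lef_pV2 ?posrE.
have : mellin_half_line h1 \is a fin_num.
  rewrite ge0_fin_numE; last by apply: integral_ge0 => t _; exact: q0.
  by rewrite (le_lt_trans ub)// ltry.
move=> /fineK hE; exists (fine (mellin_half_line h1)); last by rewrite hE.
by move: lb; rewrite -hE lee_fin; apply: lt_le_trans; lra.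
Qed.

(** Integrand of Gamma (k / 2) with respect to dt / t, cut off to t > 0; at |v|^2 / 2 it is a power
    of |v| times the Gaussian exponential, up to a constant. *)
Let gk (k : nat) : R -> R :=
  fun t => (\1_(`]0%R, +oo[%classic) t * (t `^ (k%:R / 2) * expR (- t)))%R.

Let measurable_gk k : measurable_fun setT (gk k).
Proof.
apply: measurable_funM; first exact: measurable_indic.
apply: measurable_funM; first exact: measurable_powR.
by apply: measurableT_comp.
Qed.

Let gk_ge0 k x : (0 <= gk k x)%R.
Proof. by rewrite !mulr_ge0// ?powR_ge0// expR_ge0. Qed.

Let gk_neg k x : (x <= 0)%R -> gk k x = 0%R.
Proof.
move=> x0; rewrite /gk indicE memNset ?mul0r//=.
by rewrite in_itv/= andbT; apply/negP; rewrite -leNgt.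
Qed.

Let mellin_gk k : mellin_half_line (gk k) =
  \int[leb]_(t in `]0%R, +oo[) (t `^ (k%:R / 2 - 1) * expR (- t))%:E.
Proof.
rewrite /mellin_half_line [RHS]integral_mkcond; apply: eq_integral => t _.
rewrite patchE /gk indicE; case: ifPn => [|_]; last by rewrite !mul0r.
rewrite inE/= in_itv/= andbT => t0; congr (_%:E).
rewrite mul1r mulrAC; congr (_ * _)%R.
rewrite powRB; first by rewrite powRr1 ?ltW.
by rewrite (gt_eqF t0) implybT.
Qed.

Definition chi_integral n m : \bar R :=
  \int[lebn n]_v (enorm v ^+ m * expR (- (dotv v v / 2)))%:E.

Lemma measurable_chi_integrand n m : measurable_fun setT
  (fun v : 'cV[R]_n => (enorm v ^+ m * expR (- (dotv v v / 2)))%:E).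
Proof.
apply/measurable_EFinP; apply: measurable_funM.
  by apply: measurable_funX; exact: measurable_enorm.
apply: measurableT_comp => //; apply: measurableT_comp => //.
apply: measurable_funM => //; under eq_fun do rewrite -enorm_sqr.
by apply: measurable_funX; exact: measurable_enorm.
Qed.

(** Dividing (|v|^2 / 2)^((m + n + 1) / 2) by |v|^(n + 1) leaves |v|^m and a power of sqrt 2. At v =
    0 the integrands differ when m = 0, whence the equality almost everywhere. *)
Let mellin_radial_gk n m : mellin_radial n (gk (m + n.+1)) =
  (Num.sqrt 2 ^- (m + n.+1))%:E * chi_integral n.+1 m.
Proof.
have mchi := @measurable_chi_integrand n.+1 m.
rewrite /chi_integral -ge0_integralZl_EFin//; last first.
  by move=> v _; rewrite lee_fin mulr_ge0// ?expR_ge0// exprn_ge0// enorm_ge0.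
apply: ae_eq_integral => //.
- apply/measurable_EFinP; apply: measurable_funM.
    apply: (measurableT_comp (measurable_gk _)); apply: measurable_funM => //.
    by apply: measurable_funX; exact: measurable_enorm.
  apply: (measurableT_comp (@measurable_invr R)); apply: measurable_funX.
  exact: measurable_enorm.
- by apply: emeasurable_funM.
exists [set 0%R]; split.
- exact: measurable_mx_set1.
- exact: lebesgue_cv_singleton0.
move=> v /= /not_implyP[_ nE]; apply: contrapT => /eqP v0; apply: nE.
have v_gt0 : (0 < enorm v)%R by rewrite lt_neqAle enorm_ge0 andbT eq_sym enorm_eq0.
rewrite -EFinM; congr (_%:E); rewrite /gk indicE mem_set/=; last first.
  by rewrite in_itv/= andbT divr_gt0// exprn_gt0.
rewrite mul1r enorm_sqr.
have -> : ((dotv v v / 2) `^ ((m + n.+1)%:R / 2) =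
    (enorm v / Num.sqrt 2) ^+ (m + n.+1))%R.
  rewrite [((m + n.+1)%:R / 2)%R]mulrC powRrM powR12_sqrt; last by rewrite divr_ge0// dotv_ge0.
  rewrite powR_mulrn ?sqrtr_ge0// sqrtrM ?dotv_ge0// sqrtrV//.
rewrite exprMn exprVn exprD.
by field; rewrite ?expf_neq0 ?gt_eqF// exprn_gt0// sqrtr_gt0.
Qed.

Let chi_integral0 n : chi_integral n 0 = (normal_peak 1 ^- n)%:E.
Proof.
have p0 : (0 < normal_peak (1 : R))%R by apply: normal_peak_gt0; exact: oner_neq0.
have : gauss_cv [set: 'cV[R]_n] = 1 by exact: probability_setT.
rewrite /gauss_cv; under eq_integral do rewrite gauss_pdfE EFinM.
have -> : chi_integral n 0 = \int[lebn n]_v (expR (- (dotv v v / 2)))%:E.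
  by apply: eq_integral => v _; rewrite expr0 mul1r.
rewrite ge0_integralZl_EFin//; last 2 first.
- have := @measurable_chi_integrand n 0.
  by under eq_fun do rewrite expr0 mul1r.
- by rewrite exprn_ge0// ltW.
move=> /(congr1 (fun x => (normal_peak 1 ^- n)%:E * x)).
by rewrite mule1 muleA -EFinM mulVf ?mul1e// gt_eqF// exprn_gt0.
Qed.

Let mellin_eq n m :
  mellin_half_line h1 * ((Num.sqrt 2 ^- (m + n.+1))%:E * chi_integral n.+1 m) =
  mellin_half_line (gk (m + n.+1)) * mellin_radial n h1.
Proof.
rewrite -mellin_radial_gk; apply: mellin_exchange => //; exact: gk_neg.
Qed.

Let mellin_radial_h1_ge0 n : 0 <= mellin_radial n h1.
Proof.
apply: integral_ge0 => v _; rewrite lee_fin mulr_ge0// invr_ge0 exprn_ge0//.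
exact: enorm_ge0.
Qed.

(** With exponent 0 one side of the exchange identity is finite and positive, so the Gamma integral
    is finite too and [Gamma], a real-valued integral, has its true value. *)
Let gamma_gk k : exists2 G : R, (0 < G)%R &
  mellin_half_line (gk k.+1) = G%:E /\ Gamma (k.+1%:R / 2) = G.
Proof.
have p0 : (0 < normal_peak (1 : R))%R by apply: normal_peak_gt0; exact: oner_neq0.
have [A A0 hA] := mellin_h1.
have := mellin_eq k 0; rewrite hA add0n chi_integral0 -!EFinM => /esym.
have r0 : (0 < A * (Num.sqrt 2 ^- k.+1 * normal_peak 1 ^- k.+1))%R.
  by rewrite !mulr_gt0// invr_gt0 exprn_gt0// sqrtr_gt0.
have mg0 : 0 <= mellin_half_line (gk k.+1).
  by rewrite mellin_gk integral_ge0// => t _; rewrite lee_fin mulr_ge0 ?powR_ge0 ?expR_ge0.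
move=> /(mule_eq_pos_fin mg0 (mellin_radial_h1_ge0 k) r0)[G [C [GE _ G0 _]]].
exists G => //; split => //.
by rewrite /Gamma /Rintegral -mellin_gk GE.
Qed.

(* [E |X| ^ m] for a standard Gaussian vector [X] of dimension [n.+1] *)
Lemma chi_integralE n m : chi_integral n.+1 m =
  (normal_peak 1 ^- n.+1 * Num.sqrt 2 ^+ m *
    (Gamma ((m + n.+1)%:R / 2) / Gamma (n.+1%:R / 2)))%:E.
Proof.
have p0 : (0 < normal_peak (1 : R))%R by apply: normal_peak_gt0; exact: oner_neq0.
have s0 : (0 < Num.sqrt 2 :> R)%R by rewrite sqrtr_gt0.
have [G1 G10 [mG1 ->]] := gamma_gk n.
have [G2 G20] := gamma_gk (m + n); rewrite -addnS => -[mG2 ->].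
have [A A0 hA] := mellin_h1.
(* Exponent 0 determines C, the radial integral of [h1], in terms of A; inserting it in the identity
   for exponent m eliminates both. *)
have := mellin_eq n 0; rewrite hA add0n chi_integral0 mG1 -!EFinM => /esym e0.
have [C CE] : exists C : R, mellin_radial n h1 = C%:E.
  have [||_ [C [_ -> _ _]]] := mule_eq_pos_fin _ (mellin_radial_h1_ge0 n) _ e0.
  - by rewrite lee_fin ltW.
  - by rewrite !mulr_gt0// invr_gt0 exprn_gt0.
  by exists C.
move: e0; rewrite CE -EFinM => -[e0].
have := mellin_eq n m; rewrite hA mG2 CE -EFinM.
move=> /(congr1 (fun x => (Num.sqrt 2 ^+ (m + n.+1) / A)%:E * x)).
rewrite !muleA -!EFinM => e1.
have {}e1 : chi_integral n.+1 m =
    (Num.sqrt 2 ^+ (m + n.+1) / A * (G2 * C))%:E.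
  rewrite -[RHS]e1 -[LHS]mul1e; congr (_%:E * _).
  by field; rewrite ?gt_eqF// exprn_gt0.
rewrite e1; congr (_%:E).
have -> : C = (A * (Num.sqrt 2 ^- n.+1 / normal_peak 1 ^+ n.+1) / G1)%R.
  by apply: (mulfI (lt0r_neq0 G10)); rewrite e0 [RHS]mulrC divfK// gt_eqF.
rewrite exprD; field.
by rewrite !gt_eqF// ?exprn_gt0.
Qed.

End chi_moments.

(** * Density of the scale mixture *)

Section scale_mixture_density.
Variable R : realType.
Local Notation lebn := (lebesgue_cv R).
Local Open Scope ereal_scope.

Lemma integral_gauss_row n (h : 'cV[R]_n -> \bar R) :
  measurable_fun setT h -> (forall v, 0 <= h v) ->
  \int[@gauss_mx R 1 n]_b h b^T = \int[@gauss_cv R n]_v h v.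
Proof.
move=> mh h0.
have mtr : measurable_fun [set: 'rV[R]_n] (fun b => b^T) by exact: measurable_trmx.
rewrite -[in LHS](@preimage_setT _ _ (fun b : 'rV[R]_n => b^T)).
rewrite -[LHS](@ge0_integral_pushforward _ _ _ _ _ _ mtr (@gauss_mx R 1 n))//.
apply: eq_measure_integral => S mS _.
rewrite -[RHS](gauss_mx_cv mS); exact: (gauss_mx_trmx mS).
Qed.

Lemma gauss_mx_scale m (c : R) (S : set 'cV[R]_m) : (0 < c)%R -> measurable S ->
  gauss_mx [set eta : 'cV[R]_m | S (c *: eta)] =
  \int[lebn m]_w (\1_S w * (c ^- m * gauss_pdf (c^-1 *: w)))%:E.
Proof.
move=> c0 mS.
have mcS : measurable [set eta : 'cV[R]_m | S (c *: eta)].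
  apply: (measurable_preimageT (f := fun eta : 'cV[R]_m => c *: eta)) => //.
  exact: measurable_scalemx.
pose f (w : 'cV[R]_m) := (\1_S w * gauss_pdf (c^-1 *: w))%:E.
have mf : measurable_fun setT f.
  apply/measurable_EFinP; apply: measurable_funM; first exact: measurable_indic.
  apply: (measurableT_comp (@measurable_gauss_pdf R m)).
  exact: measurable_scalemx.
have f0 w : 0 <= f w by rewrite lee_fin mulr_ge0// gauss_pdf_ge0.
transitivity ((c ^- m)%:E * \int[lebn m]_w f w).
  rewrite -(ge0_integral_lebesgue_cv_scale c0 mf f0) gauss_mx_cv//.
  rewrite /gauss_cv integral_mkcond; apply: eq_integral => w _.
  by rewrite epatch_indic muleC /f scalerA mulVf ?scale1r ?gt_eqF.
rewrite -ge0_integralZl_EFin//; last by rewrite invr_ge0 exprn_ge0// ltW.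
by apply: eq_integral => w _; rewrite -EFinM mulrCA.
Qed.

(** For nonzero v and positive a, the density at w of a eta / |v| with eta standard Gaussian. *)
Let radial_kernel m n (a : R) (v : 'cV[R]_n) (w : 'cV[R]_m) : R :=
  ((enorm v / a) ^+ m * gauss_pdf ((enorm v / a) *: w))%R.

Let radial_kernel_ge0 m n (a : R) (v : 'cV[R]_n) (w : 'cV[R]_m) :
  (0 < a)%R -> (0 <= radial_kernel a v w)%R.
Proof.
move=> a0; rewrite mulr_ge0 ?gauss_pdf_ge0// exprn_ge0// divr_ge0 ?(ltW a0)//.
exact: enorm_ge0.
Qed.

Let measurable_radial_kernel m n (a : R) : measurable_fun setT
  (fun vw : 'cV[R]_n * 'cV[R]_m => radial_kernel a vw.1 vw.2).
Proof.
have me : measurable_fun setT (fun vw : 'cV[R]_n * 'cV[R]_m => enorm vw.1 / a)%R.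
  by apply: measurable_funM => //; exact: measurable_enorm.
apply: measurable_funM; first exact: measurable_funX.
apply: (measurableT_comp (@measurable_gauss_pdf R m)).
exact: measurable_scalemx.
Qed.

(** Source of the power of sqrt pi in the final constant. *)
Lemma normal_peak_sqrt2 : (normal_peak 1 * Num.sqrt 2 = (Num.sqrt pi)^-1 :> R)%R.
Proof.
rewrite /normal_peak expr1n mul1r -mulr_natr sqrtrM ?pi_ge0// invfM -mulrA.
by rewrite mulVf ?mulr1// gt_eqF// sqrtr_gt0.
Qed.

Definition t_kernel m n (a : R) (w : 'cV[R]_m) : R :=
  (((Num.sqrt pi * a) ^+ m)^-1 *
    (Gamma ((m + n)%:R / 2) / Gamma (n%:R / 2)) *
    (1 + dotv w w / a ^+ 2) `^ (- ((m + n)%:R / 2)))%R.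

(** The two exponents add up to - q |v|^2 / 2 with q = 1 + |w|^2 / a^2. Rescaling v by sqrt q
    produces [chi_integral] and the power - (m + n + 1) / 2 of q: m comes from the factor |v|^m, n +
    1 from the Jacobian. *)
Let integral_radial_kernel m n (a : R) (w : 'cV[R]_m) : (0 < a)%R ->
  \int[lebn n.+1]_v (radial_kernel a v w * gauss_pdf v)%:E =
  (t_kernel n.+1 a w)%:E.
Proof.
move=> a0; set q := (1 + dotv w w / a ^+ 2)%R.
have q0 : (0 < q)%R.
  by rewrite ltr_pwDl// divr_ge0 ?dotv_ge0// exprn_ge0// ltW.
have sq0 : (0 < Num.sqrt q)%R by rewrite sqrtr_gt0.
have p0 : (0 < normal_peak (1 : R))%R by apply: normal_peak_gt0; exact: oner_neq0.
pose f (u : 'cV[R]_n.+1) := (enorm u ^+ m * expR (- (dotv u u / 2)))%:E.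
have f0 u : 0 <= f u.
  by rewrite lee_fin mulr_ge0 ?expR_ge0// exprn_ge0// enorm_ge0.
have mf : measurable_fun setT f by exact: measurable_chi_integrand.
pose c := (a ^- m * normal_peak 1 ^+ (m + n.+1) * Num.sqrt q ^- m)%R.
have c0 : (0 <= c)%R.
  by rewrite !mulr_ge0 ?invr_ge0 ?exprn_ge0// ltW.
transitivity (\int[lebn n.+1]_v (c%:E * f (Num.sqrt q *: v))).
  apply: eq_integral => v _; rewrite /f -EFinM; congr (_%:E).
  rewrite /radial_kernel !gauss_pdfE enormZ (ger0_norm (sqrtr_ge0 _)).
  rewrite !dotvZl !dotvZr exprMn exprVn exprMn /c.
  have -> : (- (Num.sqrt q * (Num.sqrt q * dotv v v) / 2) =
      - (enorm v / a * (enorm v / a * dotv w w) / 2) + - (dotv v v / 2))%R.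
    rewrite (mulrA (Num.sqrt q)) -expr2 (sqr_sqrtr (ltW q0)).
    rewrite (mulrA (enorm v / a)%R) -expr2 exprMn enorm_sqr /q.
    by field; rewrite gt_eqF.
  by rewrite expRD exprD; field; rewrite !gt_eqF// ?exprn_gt0.
rewrite ge0_integralZl_EFin//; last first.
  by apply: (measurableT_comp mf); exact: measurable_scalemx.
rewrite ge0_integral_lebesgue_cv_scale// -/(chi_integral R n.+1 m) chi_integralE.
rewrite -!EFinM; congr (_%:E); rewrite /t_kernel -/q /c.
have -> : (q `^ (- ((m + n.+1)%:R / 2)) = Num.sqrt q ^- m * Num.sqrt q ^- n.+1)%R.
  rewrite powRN [((m + n.+1)%:R / 2)%R]mulrC powRrM powR12_sqrt ?(ltW q0)//.
  by rewrite powR_mulrn ?sqrtr_ge0// exprD invfM.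
have -> : ((Num.sqrt pi * a) ^- m = normal_peak 1 ^+ m * Num.sqrt 2 ^+ m * a ^- m)%R.
  by rewrite exprMn invfM -exprMn normal_peak_sqrt2 exprVn.
rewrite exprD; set G := (_ / Gamma _)%R.
by field; rewrite !gt_eqF// ?exprn_gt0.
Qed.

Lemma scale_mixture_density m n (a : R) (S : set 'cV[R]_m) : (0 < a)%R ->
  measurable S ->
  scale_mixture n.+1 a S = \int[lebn m]_(w in S) (t_kernel n.+1 a w)%:E.
Proof.
move=> a0 mS.
pose k (vw : 'cV[R]_n.+1 * 'cV[R]_m) : R :=
  (\1_S vw.2 * radial_kernel a vw.1 vw.2)%R.
have k0 vw : (0 <= k vw)%R by rewrite mulr_ge0// radial_kernel_ge0.
have mk : measurable_fun setT k.
  apply: measurable_funM; last exact: measurable_radial_kernel.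
  by apply: (measurableT_comp (measurable_indic mS)).
pose H (v : 'cV[R]_n.+1) := \int[lebn m]_w (k (v, w))%:E.
have mH : measurable_fun setT H.
  apply: (measurable_fun_fubini_tonelli_F (EFin \o k)) => //.
  exact/measurable_EFinP.
have H0 v : 0 <= H v by apply: integral_ge0 => w _; rewrite lee_fin.
transitivity (\int[@gauss_mx R 1 n.+1]_b H b^T).
  apply: eq_integral_gauss_row.
  - exact: measurable_scale_mixture_integrand.
  - by apply: (measurableT_comp mH); exact: measurable_trmx.
  move=> b b0.
  have bn0 : (0 < enorm b^T)%R.
    rewrite lt_neqAle enorm_ge0 andbT eq_sym enorm_eq0.
    by rewrite -(trmx0 _ _ _) (inj_eq trmx_inj).
  rewrite (gauss_mx_scale (divr_gt0 a0 bn0) mS) /H; apply: eq_integral => w _.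
  by rewrite /k /= /radial_kernel invf_div -exprVn invf_div.
rewrite integral_gauss_row// ge0_integral_gauss_cv//.
transitivity (\int[lebn n.+1]_v \int[lebn m]_w (k (v, w) * gauss_pdf v)%:E).
  apply: eq_integral => v _; rewrite -ge0_integralZr//.
  - by apply/measurable_EFinP; apply: (measurableT_comp mk).
  - by move=> w _; rewrite lee_fin.
  - by rewrite lee_fin gauss_pdf_ge0.
rewrite (fubini_tonelli (fun vw => (k vw * gauss_pdf vw.1)%:E)); last 2 first.
- apply/measurable_EFinP; apply: measurable_funM => //.
  by apply: (measurableT_comp (@measurable_gauss_pdf R n.+1)).
- by move=> vw; rewrite lee_fin mulr_ge0// gauss_pdf_ge0.
rewrite [RHS]integral_mkcond; apply: eq_integral => w _.
rewrite patchE /k /=; under eq_integral do rewrite indicE.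
case: ifPn => _; last first.
  by apply: integral0_eq => v _; rewrite !mul0r.
by under eq_integral do rewrite mul1r; exact: integral_radial_kernel.
Qed.

Lemma measurable_t_kernel m n (a : R) :
  measurable_fun setT (@t_kernel m n a).
Proof.
apply: measurable_funM => //; apply: (measurableT_comp (@measurable_powR R _)).
apply: measurable_funD => //; apply: measurable_funM => //.
under eq_fun do rewrite -enorm_sqr.
by apply: measurable_funX; exact: measurable_enorm.
Qed.

End scale_mixture_density.

(** * Effective subspaces *)

Section effective_subspace.
Variable R : realType.

Lemma orthocomp_column_span n k (U : 'M[R]_(n, k)) (v : 'cV[R]_n) :
  orthocomp [set` column_span U] v <-> U^T *m v = 0.
Proof.
split=> [Uv|Uv u].
  apply/colP => j; rewrite [RHS]mxE.
  have := Uv (col j U); rewrite /= => <-.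
    by rewrite dotv_mulmx tr_col -row_mul [RHS]mxE.
  by apply: memv_span; apply/map_f; rewrite mem_enum.
rewrite /= => /(@coord_span _ _ _ (in_tuple _)) ->.
rewrite dotv_mulmx linear_sum mulmx_suml summxE big1// => i _.
rewrite linearZ /= -scalemxAl mxE.
have /mapP[j _ ->] : [seq col j U | j <- enum 'I_k]`_i \in
    [seq col j U | j <- enum 'I_k] by exact: mem_nth.
by rewrite tr_col -row_mul Uv row0 mxE mulr0.
Qed.

(** Lying in the affine space through the projection of x means that U^T annihilates the difference
    with x; the orthogonal Q replaces these equations by equivalent ones. *)
Lemma Sstar_solutions D d k (U : 'M[R]_(D, k)) (Q : 'M[R]_k) (x p : 'cV[R]_D)
    (M : 'M[R]_(D, d)) :
  orthonormal_columns U -> Q^T *m Q = 1%:M ->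
  Sstar (Gstar (column_span U) (column_proj U x)) M p =
  solutions (Q *m (U^T *m (x - p))) (Q *m U^T *m M).
Proof.
move=> oU QQ; apply/seteqP; split=> y.
  move=> [v /orthocomp_column_span Uv]; rewrite /column_proj => E.
  rewrite /solutions/= -!mulmxA; congr (Q *m _).
  rewrite (_ : M *m y = U *m U^T *m x + v - p); last by rewrite E addrK.
  by rewrite 2!mulmxDr Uv addr0 !mulmxA oU mul1mx mulmxBr mulmxN.
rewrite /solutions/= => /(congr1 (mulmx Q^T)); rewrite !mulmxA QQ !mul1mx => E.
exists (M *m y + p - column_proj U x); last by rewrite addrC subrK.
apply/orthocomp_column_span; rewrite /column_proj mulmxBr mulmxDr !mulmxA oU.
by rewrite mul1mx E mulmxBr subrK subrr.
Qed.

Lemma col_rotation k (u v : 'cV[R]_k.+1) : enorm u = enorm v ->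
  exists2 Q : 'M[R]_k.+1, Q^T *m Q = 1%:M & Q *m u = v.
Proof.
move=> uv; have [Q1 Q1Q uQ] := row_rotation u^T.
have [Q2 Q2Q vQ] := row_rotation v^T.
exists (Q2 *m Q1^T).
  by rewrite trmx_mul trmxK mulmxA -(mulmxA Q1) (mulmx1C Q2Q) mulmx1.
rewrite -mulmxA -[u]trmxK -trmx_mul uQ trmxK uv -{1}[v]trmxK -vQ.
by rewrite trmx_mul !trmxK mulmxA Q2Q mul1mx.
Qed.

(** Meant for a stack of [k.+1 + (D - k.+1)] rows, a number equal to D only propositionally. *)
Lemma gauss_mx_mull_rect D m n (W : 'M[R]_(m, D)) (S : set 'M[R]_(m, n)) :
  m = D -> W *m W^T = 1%:M -> measurable S ->
  gauss_mx [set M | S (W *m M)] = gauss_mx S.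
Proof.
move=> mD; case: _ / mD W => W WW mS.
by apply: gauss_mx_mull => //; exact: mulmx1C.
Qed.

(** With nu = n + 1 and Sigma = (a^2 / nu) I, the factor det(Sigma)^(-1/2) turns (pi nu)^(-l/2) into
    (sqrt pi a)^(-l), and nu cancels in the quadratic form. *)
Lemma t_pdf_scalar l n (a : R) (t : 'cV[R]_l) : 0 < a ->
  t_pdf n.+1%:R ((a ^+ 2 / n.+1%:R)%:M) t = t_kernel n.+1 a t.
Proof.
move=> a0; rewrite /t_pdf /t_kernel.
have n0 : 0 < n.+1%:R :> R by rewrite ltr0n.
have q0 : 0 < a ^+ 2 / n.+1%:R by rewrite divr_gt0// exprn_gt0.
have powh (x : R) : 0 <= x -> x `^ (l%:R / 2) = Num.sqrt x ^+ l.
  by move=> x0; rewrite mulrC powRrM powR12_sqrt// powR_mulrn// sqrtr_ge0.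
rewrite -natrD det_scalar invmx_scalar mul_mx_scalar -scalemxAl mxE -dotv_mulmx.
rewrite -(powR_mulrn l (ltW q0)) -powRrM mulrN div1r (powRN (a ^+ 2 / n.+1%:R)).
rewrite !powh ?(ltW q0)//; last by rewrite mulr_ge0// pi_ge0.
congr (_ * _); last first.
  congr ((_ + _) `^ _); rewrite invf_div; field.
  by rewrite !gt_eqF.
rewrite mulrAC; congr (_ * _); rewrite -invfM -exprMn; congr ((_ ^+ _)^-1).
rewrite -sqrtrM; last by rewrite mulr_ge0 ?pi_ge0// ltW.
rewrite (_ : pi * n.+1%:R * (a ^+ 2 / n.+1%:R) = pi * a ^+ 2); last first.
  by field; rewrite gt_eqF.
by rewrite sqrtrM ?pi_ge0// sqrtr_sqr gtr0_norm.
Qed.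

Lemma Gamma_ge0 (z : R) : 0 <= Gamma z.
Proof.
apply: fine_ge0; apply: integral_ge0 => t _.
by rewrite lee_fin mulr_ge0 ?powR_ge0// expR_ge0.
Qed.

Lemma t_kernel_ge0 l n (a : R) (t : 'cV[R]_l) : 0 < a -> 0 <= t_kernel n a t.
Proof.
move=> a0; rewrite /t_kernel !mulr_ge0 ?powR_ge0 ?invr_ge0 ?Gamma_ge0//.
by rewrite exprn_ge0// mulr_ge0 ?sqrtr_ge0// ltW.
Qed.

End effective_subspace.

Theorem theorem3p3 (R : realType) (D d de : nat) (f : 'cV[R]_D -> R)
    (T : {vspace 'cV[R]_D}) (U : 'M[R]_(D, de)) (V : 'M[R]_(D, D - de))
    (xstar p : 'cV[R]_D)
    (disp : measure_display) (Omega : measurableType disp)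
    (P : probability Omega R) (A : Omega -> 'M[R]_(D, d)) :
  continuous f ->
  (de < D)%N -> (de <= d)%N ->
  is_effective_subspace f de T ->
  orthonormal_columns U -> column_span U = T ->
  orthonormal_columns V -> [set` column_span V] = orthocomp [set` T] ->
  global_minimizer f (@symmetric_box R D) xstar ->
  symmetric_box p ->
  gaussian_matrix P A ->
  column_proj U p <> column_proj U xstar ->
  let m := (D - de)%N in
  let n := (d - de + 1)%N in
  let delta := enorm (column_proj U xstar - column_proj U p) in
  let y2 := fun omega : Omega =>
    min_norm_point (Sstar (Gstar T (column_proj U xstar)) (A omega) p) in
  let w := fun omega : Omega => V^T *m A omega *m y2 omega in
  let g := fun wbar : 'cV[R]_m =>
    ((Num.sqrt pi * delta) ^+ m)^-1 *
    (Gamma ((m + n)%:R / 2 : R) / Gamma (n%:R / 2)) *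
    (1 + (wbar^T *m wbar) ord0 ord0 / delta ^+ 2) `^ (- ((m + n)%:R / 2)) in
  t_distributed P w n%:R ((delta ^+ 2 / n%:R)%:M : 'M[R]_m) /\
  has_pdf P w g.
Proof.
move=> _ deD ded _ oU spU oV spV _ _ gA pneq m n delta y2 w g.
have delta0 : 0 < delta.
  rewrite lt_neqAle enorm_ge0 andbT eq_sym enorm_eq0 subr_eq0 eq_sym.
  exact/eqP.
have nE : n = (d - de).+1 by rewrite /n addn1.
have gE : g = t_kernel n delta.
  by apply/funext => t; rewrite /g /t_kernel dotv_mulmx.
have -> : t_distributed P w n%:R ((delta ^+ 2 / n%:R)%:M : 'M[R]_m) = has_pdf P w g.
  rewrite /t_distributed; congr has_pdf; apply/funext => t.
  by rewrite gE nE t_pdf_scalar.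
suff : has_pdf P w g by [].
rewrite gE {g gE}.
(* For de = 0 both projections are 0, against the assumption that they differ; so there is at least
   one equation. *)
case: de U V deD ded oU spU oV spV pneq @m @n @delta @y2 @w delta0 nE
  => [|k] U V deD ded oU spU oV spV pneq m n delta y2 w delta0 nE.
  by case: pneq; rewrite /column_proj [U]thinmx0 !mul0mx.
have UV0 : U^T *m V = 0.
  apply/matrixP => i j; rewrite [RHS]mxE.
  have : orthocomp [set` column_span U] (col j V).
    rewrite spU -spV /=; apply: memv_span; apply/map_f; exact: mem_enum.
  by move=> /orthocomp_column_span/colP/(_ i); rewrite colE mulmxA -colE [RHS]mxE => <-; rewrite [RHS]mxE.
(* U preserves norms, so [U^T *m (xstar - p)] has norm delta and can be rotated onto the last
   axis. *)
have [Q QQ Qz] : exists2 Q : 'M[R]_k.+1, Q^T *m Q = 1%:M &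
    Q *m (U^T *m (xstar - p)) = last_cv k delta.
  apply: col_rotation.
  have -> : enorm (last_cv k delta) = delta.
    rewrite /enorm /dotv (bigD1 ord_max)//= big1 => [|i /negbTE imax].
      by rewrite addr0 !mxE eqxx -expr2 sqrtr_sqr gtr0_norm.
    by rewrite !mxE imax mul0r.
  rewrite /delta /column_proj -mulmxBr -mulmxA /enorm [in RHS]dotv_mull.
  by rewrite (mulmxA U^T) oU mul1mx.
(* Only the equations are rotated: the block V^T A, and with it w, is unchanged. *)
pose W : 'M[R]_(k.+1 + m, D) := col_mx (Q *m U^T) V^T.
have WW : W *m W^T = 1%:M.
  rewrite /W tr_col_mx mul_col_row !trmx_mul !trmxK.
  rewrite mulmxA -(mulmxA Q) oU mulmx1 (mulmx1C QQ) oV.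
  rewrite -mulmxA UV0 mulmx0 mulmxA.
  rewrite (_ : V^T *m U = 0) ?mul0mx ?scalar_mx_block//.
  by rewrite -[U]trmxK -trmx_mul UV0 trmx0.
have wE omega : w omega = min_norm_image (last_cv k delta) (W *m A omega).
  rewrite /w /y2 /min_norm_image mul_col_mx col_mxKu col_mxKd -spU.
  by rewrite (Sstar_solutions _ _ _ oU QQ) Qz.
have mA : measurable_fun setT A by case: gA => mA _ _; exact: measurable_fun_mx.
have mimg : measurable_fun setT
    (fun M : 'M[R]_(D, d) => min_norm_image (last_cv k delta) (W *m M)).
  apply: (measurableT_comp (measurable_min_norm_image _)).
  exact: measurable_mulmxl.
have wcomp : w = (fun M : 'M[R]_(D, d) =>
    min_norm_image (last_cv k delta) (W *m M)) \o A by exact/funext.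
split.
- by rewrite wcomp; exact: measurableT_comp.
- exact: measurable_t_kernel.
- by move=> t; exact: t_kernel_ge0.
move=> B mB; rewrite nE -scale_mixture_density//.
rewrite /pushforward wcomp comp_preimage (gaussian_matrix_law gA); last first.
  exact: measurable_preimageT.
rewrite (gauss_mx_mull_rect (W := W)
  (S := min_norm_image (last_cv k delta) @^-1` B)) //; last 2 first.
- by rewrite /m subnKC// ltnW.
- exact: (measurable_preimageT (measurable_min_norm_image _)).
(* Each of the k = de - 1 eliminations costs one unknown; the remaining d - de + 1 are the degrees
   of freedom. *)
have dE : d = (k + (d - k.+1).+1)%N by rewrite addnS -addSn subnKC.
have := @gauss_mx_min_norm_image R k m (d - k.+1) delta B mB.
by case: _ / dE.
Qed.
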